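(* Let $P_O$ be the octahedron, geometrically embedded in $\mathbb{R}^8$, with facets numbered $1,\dots,8$ as in the context, and let $Z(P_O)$ be the associated singular intersection of ellipsoids. The orbifold fundamental group $\pi_1^{\mathrm{orb}}(P_O)$ is generated by $x_1,\dots,x_8$ with relations $x_i^2=1$ ($i=1,\dots,8$), $[x_i,x_j]=1$ for $$(i,j)\in\{(1,2),(2,3),(3,4),(4,1),(5,6),(6,7),(7,8),(8,5),(1,6),(2,5),(3,8),(4,7)\},$$ and $[x_i,x_j]=1$ for $$(i,j)\in\{(1,3),(2,4),(5,7),(6,8),(1,7),(4,6),(1,5),(2,6),(3,7),(4,8),(3,8),(4,7),(3,5),(2,8)\}.$$ The fundamental group of $Z(P_O)$ is isomorphic to $\mathbb{Z}^4$.
   Context: Let the octahedron have vertices $A,B,C,D,E,F$ with opposite pairs $(A,F)$, $(B,E)$, $(C,D)$, and facets $1=ABC$, $2=ABD$, $3=ADE$, $4=ACE$, $5=BDF$, $6=BCF$, $7=CEF$, $8=DEF$. A polytope $P$ with $n$ facets is geometrically embedded if it is realized as $P=L\cap\mathbb{R}^n_{\ge 0}$ for an affine subspace $L\subset\{r_1+\dots+r_n=1\}$ with $\dim L=\dim P$, so that its facets are exactly its intersections with the coordinate hyperplanes $\{r_i=0\}$. Then $Z(P)=\{x\in\mathbb{R}^n : (x_1^2,\dots,x_n^2)\in P\}$. The group $(\mathbb{Z}/2)^n$ acts on $Z(P)$ by sign changes with quotient $P$, which gives $P$ an orbifold structure in which a point lying in exactly $k$ coordinate hyperplanes has isotropy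 group $(\mathbb{Z}/2)^k$ (including the non-simple vertices). The orbifold fundamental group of $P$ is the one of this structure; $x_i$ is the generator corresponding to the reflection in the $i$-th facet, and $\pi_1(Z(P))$ is the kernel of the natural epimorphism $\pi_1^{\mathrm{orb}}(P)\to(\mathbb{Z}/2)^n$ sending $x_i$ to the $i$-th basis vector. *)

(* Defs.v *)
From HB Require Import structures.
From mathcomp Require Import all_boot all_order all_algebra.
From mathcomp Require Import generic_quotient ring lra.
From mathcomp Require Import all_classical all_reals all_analysis.

Set Implicit Arguments.
Unset Strict Implicit.
Unset Printing Implicit Defensive.

Import Order.TTheory GRing.Theory Num.Theory.
Import numFieldNormedType.Exports.

Local Open Scope classical_set_scope.
Local Open Scope ring_scope.

Section WithinContinuous.
Context {U V T : topologicalType}.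

Lemma within_comp (A : set U) (B : set V) (f : U -> V) (g : V -> T) :
  {within A, continuous f} -> (forall u, A u -> B (f u)) ->
  {within B, continuous g} -> {within A, continuous (g \o f)}.
Proof.
move=> /subspace_continuousP cf AB /subspace_continuousP cg.
apply/subspace_continuousP => u Au.
apply: (@cvg_trans _ (g @ within B (nbhs (f u)))); last exact: cg (AB _ Au).
move=> W /=; rewrite /nbhs /= => gW.
have := cf _ Au _ gW; rewrite /nbhs /= /within /=.
by apply: filterS => v + Av; apply => //; exact: AB.
Qed.

Lemma within_eq (A : set U) (f g : U -> T) :
  (forall u, A u -> f u = g u) ->
  {within A, continuous f} -> {within A, continuous g}.
Proof.
move=> fg; apply: subspace_eq_continuous => u; rewrite inE; exact: fg.
Qed.

Lemma within_glue (R : realType) (A : set U) (c : U -> R) (f g : U -> T) :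
  closed A -> continuous c ->
  {within A `&` [set u | c u <= 1], continuous f} ->
  {within A `&` [set u | 1 <= c u], continuous g} ->
  (forall u, A u -> c u = 1 -> f u = g u) ->
  {within A, continuous (fun u => if c u <= 1 then f u else g u)}.
Proof.
move=> cA cc cf cg fg.
have -> : A = (A `&` [set u | c u <= 1]) `|` (A `&` [set u | 1 <= c u]).
  rewrite -setIUr; apply/seteqP; split=> [u Au|u []//].
  by split => //; case: (leP (c u) 1) => [|/ltW]; [left|right].
apply: withinU_continuous.
- apply: closedI => //.
  by apply: (@closed_comp _ _ c [set r | r <= 1]); [move=> *; exact: cc|exact: closed_le].
- apply: closedI => //.
  by apply: (@closed_comp _ _ c [set r | 1 <= r]); [move=> *; exact: cc|exact: closed_ge].
- by apply: within_eq cf => u [_ /= ->].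
- apply: within_eq cg => u [Au /= c1]; case: ifPn => // c1'.
  by rewrite fg//; apply/eqP; rewrite eq_le c1' c1.
Qed.

End WithinContinuous.

Section Paths.
Context {R : realType} {T : topologicalType}.
Implicit Types (S : set T) (f g h k : R -> T) (phi psi : R -> R).

Definition unit_interval : set R := `[0, 1]%classic.
Local Notation I := unit_interval.
Local Notation II := (unit_interval `*` unit_interval).

Definition is_path S (x y : T) f :=
  [/\ {within I, continuous f}, (forall s, I s -> S (f s)), f 0 = x & f 1 = y].

(* homotopy in S relative to the endpoints *)
Definition homotopic S f g := exists H : R * R -> T,
  [/\ {within II, continuous H}, (forall p, II p -> S (H p)),
      (forall s, I s -> H (s, 0) = f s /\ H (s, 1) = g s) &
      (forall t, I t -> H (0, t) = f 0 /\ H (1, t) = f 1)].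

Definition path_cat f g : R -> T :=
  fun s => if 2 * s <= 1 then f (2 * s) else g (2 * s - 1).

Definition path_rev f : R -> T := fun s => f (1 - s).

Lemma I0 : I 0. Proof. by rewrite /unit_interval /= in_itv /= lexx ler01. Qed.
Lemma I1 : I 1. Proof. by rewrite /unit_interval /= in_itv /= lexx ler01. Qed.
Lemma IE s : I s <-> 0 <= s <= 1.
Proof. by rewrite /unit_interval /= in_itv. Qed.

Lemma two_sub1 : 2 - 1 = 1 :> R. Proof. lra. Qed.
Lemma two_le1 : (2 <= 1 :> R) = false. Proof. by apply/negbTE; lra. Qed.

Lemma closed_II : closed (II : set (R * R)).
Proof.
have -> : II = (fst @^-1` I `&` snd @^-1` I : set (R * R)) by [].
apply: closedI; apply: closed_comp.
- by move=> *; exact: cvg_fst.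
- exact: itv_closed.
- by move=> *; exact: cvg_snd.
- exact: itv_closed.
Qed.

Lemma is_path_cst S x : S x -> is_path S x x (cst x).
Proof. by move=> Sx; split=> //; apply: continuous_subspaceT => s; exact: cvg_cst. Qed.

Lemma is_path_cat S x y z f g :
  is_path S x y f -> is_path S y z g -> is_path S x z (path_cat f g).
Proof.
move=> [cf Sf f0 f1] [cg Sg g0 g1]; split.
- apply: (@within_glue _ _ R I (fun s => 2 * s) (fun s => f (2 * s))
    (fun s => g (2 * s - 1))).
  + exact: itv_closed.
  + by move=> s; apply: cvgM; [exact: cvg_cst|exact: cvg_id].
  + apply: (@within_comp _ _ _ _ I (fun s : R => 2 * s) f) => //.
      apply: continuous_subspaceT => s.
      by apply: cvgM; [exact: cvg_cst|exact: cvg_id].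
    by move=> s [/IE ? /= ?]; apply/IE; lra.
  + apply: (@within_comp _ _ _ _ I (fun s : R => 2 * s - 1) g) => //.
      apply: continuous_subspaceT => s; apply: cvgB; last exact: cvg_cst.
      by apply: cvgM; [exact: cvg_cst|exact: cvg_id].
    by move=> s [/IE ? /= ?]; apply/IE; lra.
  + by move=> s _ ->; rewrite subrr f1 g0.
- move=> s /IE s01; rewrite /path_cat; case: ifPn => [?|].
    by apply: Sf; apply/IE; lra.
  by rewrite -ltNge => ?; apply: Sg; apply/IE; lra.
- by rewrite /path_cat mulr0 ler01.
- by rewrite /path_cat mulr1 two_le1 two_sub1.
Qed.

Lemma is_path_rev S x y f : is_path S x y f -> is_path S y x (path_rev f).
Proof.
move=> [cf Sf f0 f1]; split.
- apply: (@within_comp _ _ _ _ I (fun s : R => 1 - s) f) => //.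
    by apply: continuous_subspaceT => s; apply: cvgB; [exact: cvg_cst|exact: cvg_id].
  by move=> s /IE ?; apply/IE; lra.
- by move=> s /IE ?; apply: Sf; apply/IE; lra.
- by rewrite /path_rev subr0.
- by rewrite /path_rev subrr.
Qed.

Lemma homotopic_reparam S x y f phi psi : is_path S x y f ->
  continuous phi -> continuous psi ->
  (forall s, I s -> I (phi s)) -> (forall s, I s -> I (psi s)) ->
  phi 0 = psi 0 -> phi 1 = psi 1 -> homotopic S (f \o phi) (f \o psi).
Proof.
move=> [cf Sf _ _] cphi cpsi Iphi Ipsi e0 e1.
pose K (p : R * R) : R := (1 - p.2) * phi p.1 + p.2 * psi p.1.
have IK p : II p -> I (K p).
  case: p => s t [/= Is /IE It]; have /IE := Iphi _ Is; have /IE := Ipsi _ Is.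
  by move=> ? ?; apply/IE; rewrite /K /=; nra.
have cK : continuous K.
  move=> p; apply: cvgD; apply: cvgM.
  - by apply: cvgB; [exact: cvg_cst|exact: cvg_snd].
  - by apply: (@continuous_comp _ _ _ fst phi); [exact: cvg_fst|exact: cphi].
  - exact: cvg_snd.
  - by apply: (@continuous_comp _ _ _ fst psi); [exact: cvg_fst|exact: cpsi].
exists (f \o K); split.
- by apply: (@within_comp _ _ _ _ I K f) => //; exact: continuous_subspaceT.
- by move=> p /IK; exact: Sf.
- by move=> s Is; rewrite /K /= subr0 subrr !mul1r !mul0r addr0 add0r.
- move=> t It; rewrite /K /= -e0 -e1 -!mulrDl.
  by rewrite subrK !mul1r.
Qed.

Lemma homotopic_eq S f g f' g' :
  (forall s, I s -> f s = f' s) -> (forall s, I s -> g s = g' s) ->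
  homotopic S f g -> homotopic S f' g'.
Proof.
move=> ff gg [H [cH SH H0 H1]]; exists H; split=> //.
  by move=> s Is; rewrite -ff// -gg//; exact: H0.
by move=> t It; rewrite -!ff; [exact: H1|exact: I1|exact: I0].
Qed.

Lemma homotopic_refl S x y f : is_path S x y f -> homotopic S f f.
Proof.
move=> [cf Sf _ _]; exists (f \o fst); split=> //.
  apply: (@within_comp _ _ _ _ I fst f) => //.
    by apply: continuous_subspaceT => p; exact: cvg_fst.
  by move=> p [].
by move=> p [] /Sf.
Qed.

Lemma homotopic_sym S f g : homotopic S f g -> homotopic S g f.
Proof.
move=> [H [cH SH H0 H1]].
pose K (p : R * R) : R * R := (p.1, 1 - p.2).
have IK p : II p -> II (K p).
  by case: p => s t [/= Is /IE It]; split => //=; apply/IE; lra.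
have cK : continuous K.
  move=> p; apply: (@cvg_pair _ _ _ _ (nbhs _) (nbhs _)); first exact: cvg_fst.
  by apply: cvgB; [exact: cvg_cst|exact: cvg_snd].
exists (H \o K); split.
- by apply: (@within_comp _ _ _ _ II K H) => //; exact: continuous_subspaceT.
- by move=> p /IK; exact: SH.
- by move=> s Is; rewrite /K /= subr0 subrr; have [-> ->] := H0 _ Is.
- move=> t It; have It' : I (1 - t) by move/IE in It; apply/IE; lra.
  rewrite /K /=; have [-> ->] := H1 _ It'.
  have [_ <-] := H0 _ I0; have [_ <-] := H0 _ I1.
  by have [-> ->] := H1 _ I1.
Qed.

Lemma homotopic_trans S f g h :
  homotopic S f g -> homotopic S g h -> homotopic S f h.
Proof.
move=> [H [cH SH H0 H1]] [K [cK SK K0 K1]].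
pose a (p : R * R) : R * R := (p.1, 2 * p.2).
pose b (p : R * R) : R * R := (p.1, 2 * p.2 - 1).
have c2 : continuous (fun p : R * R => 2 * p.2).
  by move=> p; apply: cvgM; [exact: cvg_cst|exact: cvg_snd].
have ca : continuous a by move=> p; apply: (@cvg_pair _ _ _ _ (nbhs _) (nbhs _)); [exact: cvg_fst|exact: c2].
have cb : continuous b.
  move=> p; apply: (@cvg_pair _ _ _ _ (nbhs _) (nbhs _)); first exact: cvg_fst.
  by apply: cvgB; [exact: c2|exact: cvg_cst].
have Ia p : II p -> 2 * p.2 <= 1 -> II (a p).
  by case: p => s t [/= Is /IE It] ?; split => //=; apply/IE; lra.
have Ib p : II p -> 1 <= 2 * p.2 -> II (b p).
  by case: p => s t [/= Is /IE It] ?; split => //=; apply/IE; lra.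
exists (fun p => if 2 * p.2 <= 1 then H (a p) else K (b p)); split.
- apply: (@within_glue _ _ R II (fun p => 2 * p.2) (H \o a) (K \o b)) => //.
  + exact: closed_II.
  + apply: (@within_comp _ _ _ _ II a H) => //; first exact: continuous_subspaceT.
    by move=> p [? ?]; exact: Ia.
  + apply: (@within_comp _ _ _ _ II b K) => //; first exact: continuous_subspaceT.
    by move=> p [? ?]; exact: Ib.
  + move=> [s t] [/= Is It] e; rewrite /a /b /= e subrr.
    by have [_ ->] := H0 _ Is; have [-> _] := K0 _ Is.
- move=> p Ip; case: ifPn => [?|]; first by apply: SH; exact: Ia.
  by rewrite -ltNge => /ltW ?; apply: SK; exact: Ib.
- move=> s Is; rewrite /a /b /= mulr0 mulr1 ler01 two_le1 two_sub1.
  by have [-> _] := H0 _ Is; have [_ ->] := K0 _ Is.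
- move=> t It; rewrite /a /b /=; case: ifPn => [?|].
    by apply: H1; move/IE in It; apply/IE; lra.
  rewrite -ltNge => ?; have I't : I (2 * t - 1) by move/IE in It; apply/IE; lra.
  have [-> ->] := K1 _ I't; have [_ <-] := H0 _ I0; have [_ <-] := H0 _ I1.
  by have [-> ->] := H1 _ I1.
Qed.

Lemma homotopic_cat S x y z f f' g g' :
  is_path S x y f -> is_path S x y f' -> is_path S y z g -> is_path S y z g' ->
  homotopic S f f' -> homotopic S g g' ->
  homotopic S (path_cat f g) (path_cat f' g').
Proof.
move=> [_ _ f0 f1] [_ _ f'0 f'1] [_ _ g0 g1] [_ _ g'0 g'1].
move=> [H [cH SH H0 H1]] [K [cK SK K0 K1]].
pose a (p : R * R) : R * R := (2 * p.1, p.2).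
pose b (p : R * R) : R * R := (2 * p.1 - 1, p.2).
have c2 : continuous (fun p : R * R => 2 * p.1).
  by move=> p; apply: cvgM; [exact: cvg_cst|exact: cvg_fst].
have ca : continuous a by move=> p; apply: (@cvg_pair _ _ _ _ (nbhs _) (nbhs _)); [exact: c2|exact: cvg_snd].
have cb : continuous b.
  move=> p; apply: (@cvg_pair _ _ _ _ (nbhs _) (nbhs _)); last exact: cvg_snd.
  by apply: cvgB; [exact: c2|exact: cvg_cst].
have Ia p : II p -> 2 * p.1 <= 1 -> II (a p).
  by case: p => s t [/= /IE Is It] ?; split => //=; apply/IE; lra.
have Ib p : II p -> 1 <= 2 * p.1 -> II (b p).
  by case: p => s t [/= /IE Is It] ?; split => //=; apply/IE; lra.
exists (fun p => if 2 * p.1 <= 1 then H (a p) else K (b p)); split.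
- apply: (@within_glue _ _ R II (fun p => 2 * p.1) (H \o a) (K \o b)) => //.
  + exact: closed_II.
  + apply: (@within_comp _ _ _ _ II a H) => //; first exact: continuous_subspaceT.
    by move=> p [? ?]; exact: Ia.
  + apply: (@within_comp _ _ _ _ II b K) => //; first exact: continuous_subspaceT.
    by move=> p [? ?]; exact: Ib.
  + move=> [s t] [/= Is It] e; rewrite /a /b /= e subrr.
    by have [_ ->] := H1 _ It; have [-> _] := K1 _ It; rewrite f1 g0.
- move=> p Ip; case: ifPn => [?|]; first by apply: SH; exact: Ia.
  by rewrite -ltNge => /ltW ?; apply: SK; exact: Ib.
- move=> s /IE Is; rewrite /a /b /path_cat /=; case: ifPn => [?|].
    by apply: H0; apply/IE; lra.
  by rewrite -ltNge => ?; apply: K0; apply/IE; lra.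
- move=> t It; rewrite /a /b /path_cat /= !mulr0 !mulr1 ler01 two_le1 two_sub1.
  by have [-> _] := H1 _ It; have [_ ->] := K1 _ It.
Qed.

Lemma homotopic_catA S x y z w f g h :
  is_path S x y f -> is_path S y z g -> is_path S z w h ->
  homotopic S (path_cat f (path_cat g h)) (path_cat (path_cat f g) h).
Proof.
move=> pf pg ph.
have p := is_path_cat pf (is_path_cat pg ph).
pose phi (s : R) := Order.min (2 * s) (Order.min (s + 4^-1) ((s + 1) / 2)).
have cphi : continuous phi.
  move=> s; apply: continuous_min.
    by apply: cvgM; [exact: cvg_cst|exact: cvg_id].
  apply: continuous_min; first by apply: cvgD; [exact: cvg_id|exact: cvg_cst].
  apply: cvgM; last exact: cvg_cst.
  by apply: cvgD; [exact: cvg_id|exact: cvg_cst].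
have phiE s : phi s = if 4 * s <= 1 then 2 * s else
    if 2 * s <= 1 then s + 4^-1 else (s + 1) / 2.
  rewrite /phi !minEle; case: (leP (s + 4^-1) ((s + 1) / 2)) => ?.
    by do ![case: leP => ?]; lra.
  by do ![case: leP => ?]; lra.
apply: (homotopic_eq (f := path_cat f (path_cat g h) \o id)
          (g := path_cat f (path_cat g h) \o phi)) => //.
- move=> s /IE ?; rewrite /= phiE /path_cat.
  have [a1|a1] := leP (4 * s) 1.
    rewrite (_ : 2 * s <= 1); last by lra.
    by rewrite (_ : 2 * (2 * s) <= 1)//; lra.
  have [a2|a2] := leP (2 * s) 1.
    rewrite (_ : 2 * (s + 4^-1) <= 1 = false); last by apply/negbTE; lra.
    rewrite (_ : 2 * (2 * (s + 4^-1) - 1) <= 1); last by lra.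
    rewrite (_ : 2 * (2 * s) <= 1 = false); last by apply/negbTE; lra.
    by congr g; lra.
  rewrite (_ : 2 * ((s + 1) / 2) <= 1 = false); last by apply/negbTE; lra.
  rewrite (_ : 2 * (2 * ((s + 1) / 2) - 1) <= 1 = false); last by apply/negbTE; lra.
  by congr h; lra.
- apply: (homotopic_reparam p) => //.
  + by move=> s; exact: cvg_id.
  + by move=> s /IE ?; apply/IE; rewrite phiE; do ?[case: ifPn; rewrite -?ltNge => ?]; lra.
  + by rewrite phiE !mulr0 ler01.
  + rewrite phiE !ifF; [lra|apply/negbTE; lra|apply/negbTE; lra].
Qed.

Lemma homotopic_cst_cat S x y f :
  is_path S x y f -> homotopic S (path_cat (cst x) f) f.
Proof.
move=> pf; pose phi (s : R) := Order.max 0 (2 * s - 1).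
have phiE s : phi s = if 2 * s <= 1 then 0 else 2 * s - 1.
  by rewrite /phi maxEle; do ![case: leP => ?]; lra.
apply: (homotopic_eq (f := f \o phi) (g := f \o id)) => //.
  move=> s _; rewrite /= phiE /path_cat; case: ifPn => // _.
  by case: pf.
apply: (homotopic_reparam pf).
- move=> s; apply: (@continuous_max R R (fun=> 0) (fun s => 2 * s - 1)); first exact: cvg_cst.
  apply: cvgB; last exact: cvg_cst.
  by apply: cvgM; [exact: cvg_cst|exact: cvg_id].
- by move=> s; exact: cvg_id.
- by move=> s /IE ?; apply/IE; rewrite phiE; case: ifPn; rewrite -?ltNge => ?; lra.
- by [].
- by rewrite phiE mulr0 ler01.
- by rewrite phiE ifF; [lra|apply/negbTE; lra].
Qed.

Lemma homotopic_cat_cst S x y f :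
  is_path S x y f -> homotopic S (path_cat f (cst y)) f.
Proof.
move=> pf; pose phi (s : R) := Order.min (2 * s) 1.
have phiE s : phi s = if 2 * s <= 1 then 2 * s else 1.
  by rewrite /phi minEle; do ![case: leP => ?]; lra.
apply: (homotopic_eq (f := f \o phi) (g := f \o id)) => //.
  move=> s _; rewrite /= phiE /path_cat; case: ifPn => // _.
  by case: pf.
apply: (homotopic_reparam pf).
- move=> s; apply: continuous_min; last exact: cvg_cst.
  by apply: cvgM; [exact: cvg_cst|exact: cvg_id].
- by move=> s; exact: cvg_id.
- by move=> s /IE ?; apply/IE; rewrite phiE; case: ifPn; rewrite -?ltNge => ?; lra.
- by [].
- by rewrite phiE mulr0 ler01.
- by rewrite phiE ifF//; apply/negbTE; lra.
Qed.

Lemma homotopic_cat_rev S x y f :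
  is_path S x y f -> homotopic S (path_cat f (path_rev f)) (cst x).
Proof.
move=> pf; pose phi (s : R) := Order.min (2 * s) (2 - 2 * s).
have phiE s : phi s = if 2 * s <= 1 then 2 * s else 2 - 2 * s.
  by rewrite /phi minEle; do ![case: leP => ?]; lra.
apply: (homotopic_eq (f := f \o phi) (g := f \o cst 0)) => //.
- move=> s _; rewrite /= phiE /path_cat; case: ifPn => // _.
  by rewrite /path_rev; congr f; lra.
- by move=> s _; case: pf.
apply: (homotopic_reparam pf).
- have c2 : continuous (fun s : R => 2 * s).
    by move=> s; apply: cvgM; [exact: cvg_cst|exact: cvg_id].
  move=> s; apply: continuous_min; first exact: c2.
  by apply: cvgB; [exact: cvg_cst|exact: c2].
- by move=> s; exact: cvg_cst.
- by move=> s /IE ?; apply/IE; rewrite phiE; case: ifPn; rewrite -?ltNge => ?; lra.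
- by move=> s _; exact: I0.
- by rewrite phiE mulr0 ler01.
- by rewrite phiE ifF/=; [lra|apply/negbTE; lra].
Qed.

Lemma homotopic_rev_cat S x y f :
  is_path S x y f -> homotopic S (path_cat (path_rev f) f) (cst y).
Proof.
move=> pf; have pf' := is_path_rev pf.
apply: homotopic_eq (homotopic_cat_rev pf') => // s _.
rewrite /path_cat; case: ifPn => // _.
by rewrite /path_rev; congr f; lra.
Qed.

End Paths.
Arguments is_path {R T}.
Arguments homotopic {R T}.

Lemma is_path_comp (R : realType) (T T' : topologicalType) (S : set T)
    (S' : set T') (F : T -> T') (x y : T) (f : R -> T) :
  continuous F -> (forall a, S a -> S' (F a)) ->
  is_path S x y f -> is_path S' (F x) (F y) (F \o f).
Proof.
move=> cF SF [cf Sf f0 f1]; split=> /=; rewrite ?f0 ?f1//.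
  apply: (@within_comp _ _ _ _ setT f F) => //; exact: continuous_subspaceT.
by move=> s /Sf /SF.
Qed.

Lemma homotopic_comp (R : realType) (T T' : topologicalType) (S : set T)
    (S' : set T') (F : T -> T') (f g : R -> T) :
  continuous F -> (forall a, S a -> S' (F a)) ->
  homotopic S f g -> homotopic S' (F \o f) (F \o g).
Proof.
move=> cF SF [H [cH SH H0 H1]]; exists (F \o H); split.
- apply: (@within_comp _ _ _ _ setT H F) => //; exact: continuous_subspaceT.
- by move=> p /SH /SF.
- by move=> s Is /=; have [-> ->] := H0 _ Is.
- by move=> t It /=; have [-> ->] := H1 _ It.
Qed.

Lemma comp_path_cat (R : realType) (T T' : topologicalType) (F : T -> T')
    (f g : R -> T) : F \o path_cat f g = path_cat (F \o f) (F \o g).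
Proof. by apply/funext => s; rewrite /path_cat /=; case: ifP. Qed.

Section PathType.
Context (R : realType) {T : topologicalType} (S : set T) (x y : T).

Record path_type := Path { path_fun :> R -> T; path_typeP : is_path S x y path_fun }.

HB.instance Definition _ := gen_eqMixin path_type.
HB.instance Definition _ := gen_choiceMixin path_type.

End PathType.

Section FundamentalGroup.
Context (R : realType) {T : topologicalType} {S : set T} (z : S).
Local Notation loop := (path_type R S (set_val z) (set_val z)).
Implicit Types f g h : loop.

Lemma set_valS : S (set_val z). Proof. exact: set_valP. Qed.

Definition loop_homotopic : rel loop := fun f g => `[< homotopic S f g >].

Lemma loop_homotopic_refl : reflexive loop_homotopic.
Proof. by move=> f; apply/asboolP; exact: homotopic_refl (path_typeP f). Qed.

Lemma loop_homotopic_sym : symmetric loop_homotopic.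
Proof. by move=> f g; apply/asboolP/asboolP; exact: homotopic_sym. Qed.

Lemma loop_homotopic_trans : transitive loop_homotopic.
Proof.
by move=> g f h /asboolP fg /asboolP gh; apply/asboolP; exact: homotopic_trans gh.
Qed.

Canonical loop_equiv := EquivRel loop_homotopic
  loop_homotopic_refl loop_homotopic_sym loop_homotopic_trans.

Definition fundamental_group : Type := {eq_quot loop_equiv}%qT.
HB.instance Definition _ := Choice.on fundamental_group.

Definition loop_class f : fundamental_group := (\pi_{eq_quot loop_equiv} f)%qT.

Definition loop_one : loop := Path (is_path_cst (R := R) set_valS).
Definition loop_mul f g : loop :=
  Path (is_path_cat (path_typeP f) (path_typeP g)).
Definition loop_inv f : loop := Path (is_path_rev (path_typeP f)).

Definition pi1_mul (a b : fundamental_group) : fundamental_group :=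
  loop_class (loop_mul (repr a) (repr b)).
Definition pi1_inv (a : fundamental_group) : fundamental_group :=
  loop_class (loop_inv (repr a)).

Lemma loop_classP f g : loop_class f = loop_class g <-> homotopic S f g.
Proof.
split=> [/eqP|fg]; first by rewrite /loop_class eqmodE => /asboolP.
by apply/eqP; rewrite /loop_class eqmodE; apply/asboolP.
Qed.

Lemma loop_classK (a : fundamental_group) : loop_class (repr a) = a.
Proof. exact: reprK. Qed.

Lemma pi1_mulE f g : pi1_mul (loop_class f) (loop_class g) = loop_class (loop_mul f g).
Proof.
apply/loop_classP => /=.
apply: homotopic_cat; try exact: path_typeP.
  by apply/loop_classP; rewrite loop_classK.
by apply/loop_classP; rewrite loop_classK.
Qed.

Let mulA : associative pi1_mul.
Proof.
move=> a b c; rewrite -(loop_classK a) -(loop_classK b) -(loop_classK c) !pi1_mulE.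
by apply/loop_classP; apply: homotopic_catA; exact: path_typeP.
Qed.

Let mul1 : left_id (loop_class loop_one) pi1_mul.
Proof.
move=> a; rewrite -(loop_classK a) pi1_mulE.
by apply/loop_classP; apply: homotopic_cst_cat; exact: path_typeP.
Qed.

Let mulr1 : right_id (loop_class loop_one) pi1_mul.
Proof.
move=> a; rewrite -(loop_classK a) pi1_mulE.
by apply/loop_classP; apply: homotopic_cat_cst; exact: path_typeP.
Qed.

Let mulV : left_inverse (loop_class loop_one) pi1_inv pi1_mul.
Proof.
move=> a; rewrite -[X in pi1_mul _ X](loop_classK a) pi1_mulE.
by apply/loop_classP; apply: homotopic_rev_cat; exact: path_typeP.
Qed.

Let mulrV : right_inverse (loop_class loop_one) pi1_inv pi1_mul.
Proof.
move=> a; rewrite -[X in pi1_mul X _](loop_classK a) pi1_mulE.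
by apply/loop_classP; apply: homotopic_cat_rev; exact: path_typeP.
Qed.

HB.instance Definition _ :=
  isGroup.Build fundamental_group mulA mul1 mulr1 mulV mulrV.

End FundamentalGroup.

Section SquarePreimage.
Context {R : realType} {n : nat}.
Implicit Types (P : set 'rV[R]_n) (x : 'rV[R]_n) (g h : 'rV['Z_2]_n).

(* Z(P) *)
Definition square_preimage P : set 'rV[R]_n :=
  [set x | P (\row_i x 0 i ^+ 2)].

Definition orthant : set 'rV[R]_n := [set x | forall i, 0 <= x 0 i].

Definition sign_change g x : 'rV[R]_n := \row_i ((-1) ^+ (g 0 i : nat) * x 0 i).

Lemma sign_change0 : sign_change 0 = id.
Proof. by apply/funext => x; apply/rowP => i; rewrite !mxE expr0 mul1r. Qed.

Lemma sign_changeD g h : sign_change (g + h) = sign_change g \o sign_change h.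
Proof.
apply/funext => x; apply/rowP => i; rewrite !mxE mulrA -exprD /=.
congr (_ * _); rewrite -[LHS]signr_odd -[RHS]signr_odd; congr (_ ^+ _).
by move: (g 0 i) (h 0 i) => [[|[|//]] ?] [[|[|//]] ?].
Qed.

Lemma sign_change_continuous g : continuous (sign_change g).
Proof.
move=> x W [B Bx BW].
exists (fun i j => (fun r : R => (-1) ^+ (g 0 j : nat) * r) @^-1` B i j).
  move=> i j; have := Bx i j; rewrite mxE ord1 => Bij.
  by apply: (cvgM (cvg_cst _) (@cvg_id _ (nbhs (x 0 j)))); exact: Bij.
by move=> y By; apply: BW => i j /=; rewrite mxE; have := By i j; rewrite ord1.
Qed.

Lemma square_preimage_sign P g x :
  square_preimage P x -> square_preimage P (sign_change g x).
Proof.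
rewrite /square_preimage /=; congr P; apply/rowP => i.
by rewrite !mxE exprMn -exprM mulnC exprM sqrrN expr1n expr1n mul1r.
Qed.

End SquarePreimage.

(* The group (Z/2)^n acts on Z(P) by sign changes.  The orbifold fundamental  *)
(* group of the quotient orbifold P = Z(P) / (Z/2)^n consists of the pairs    *)
(* (g, [f]) with f a path of Z(P) from z to g z, multiplied by                *)
(* (g, [f]) (h, [k]) = (g h, [f . g k]).  It is an extension of (Z/2)^n by    *)
(* pi_1(Z(P), z), which is the subgroup g = 0.                                *)
Section OrbifoldGroup.
Context {R : realType} {n : nat} {P : set 'rV[R]_n} (z : square_preimage P).
Local Notation Z := (square_preimage P).
Local Notation z0 := (set_val z).

Record orbi_path := OrbiPath {
  orbi_sign : 'rV['Z_2]_n;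
  orbi_fun : R -> 'rV[R]_n;
  orbi_pathP : is_path Z z0 (sign_change orbi_sign z0) orbi_fun }.
Implicit Types f k : orbi_path.

HB.instance Definition _ := gen_eqMixin orbi_path.
HB.instance Definition _ := gen_choiceMixin orbi_path.

Definition orbi_homotopic : rel orbi_path := fun f k =>
  (orbi_sign f == orbi_sign k) && `[< homotopic Z (orbi_fun f) (orbi_fun k) >].

Lemma orbi_homotopic_refl : reflexive orbi_homotopic.
Proof.
move=> f; rewrite /orbi_homotopic eqxx /=.
by apply/asboolP; exact: homotopic_refl (orbi_pathP f).
Qed.

Lemma orbi_homotopic_sym : symmetric orbi_homotopic.
Proof.
move=> f k; rewrite /orbi_homotopic eq_sym; congr (_ && _).
by apply/asboolP/asboolP; exact: homotopic_sym.
Qed.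

Lemma orbi_homotopic_trans : transitive orbi_homotopic.
Proof.
move=> g f h /andP[/eqP sfg /asboolP fg] /andP[/eqP sgh /asboolP gh].
by rewrite /orbi_homotopic sfg sgh eqxx /=; apply/asboolP; exact: homotopic_trans gh.
Qed.

Canonical orbi_equiv := EquivRel orbi_homotopic
  orbi_homotopic_refl orbi_homotopic_sym orbi_homotopic_trans.

Definition orbifold_group : Type := {eq_quot orbi_equiv}%qT.
HB.instance Definition _ := Choice.on orbifold_group.

Definition orbi_class f : orbifold_group := (\pi_{eq_quot orbi_equiv} f)%qT.

Lemma is_path_sign g (x y : 'rV[R]_n) (f : R -> 'rV[R]_n) :
  is_path Z x y f ->
  is_path Z (sign_change g x) (sign_change g y) (sign_change g \o f).
Proof.
apply: is_path_comp; first exact: sign_change_continuous.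
exact: square_preimage_sign.
Qed.

Lemma homotopic_sign g (f k : R -> 'rV[R]_n) :
  homotopic Z f k -> homotopic Z (sign_change g \o f) (sign_change g \o k).
Proof.
apply: homotopic_comp; first exact: sign_change_continuous.
exact: square_preimage_sign.
Qed.

Lemma orbi_one_subproof : is_path Z z0 (sign_change 0 z0) (cst z0 : R -> _).
Proof. by rewrite sign_change0; apply: is_path_cst; exact: set_valS. Qed.

Lemma orbi_mul_subproof f k : is_path Z z0
  (sign_change (orbi_sign f + orbi_sign k) z0)
  (path_cat (orbi_fun f) (sign_change (orbi_sign f) \o orbi_fun k)).
Proof.
rewrite sign_changeD; apply: is_path_cat (orbi_pathP f) _.
exact: is_path_sign (orbi_pathP k).
Qed.

Lemma orbi_inv_subproof f : is_path Z z0 (sign_change (- orbi_sign f) z0)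
  (sign_change (- orbi_sign f) \o path_rev (orbi_fun f)).
Proof.
have := is_path_sign (- orbi_sign f) (is_path_rev (orbi_pathP f)).
have -> // : sign_change (- orbi_sign f) (sign_change (orbi_sign f) z0) = z0.
by have := congr1 (@^~ z0) (sign_changeD (R := R) (- orbi_sign f) (orbi_sign f));
  rewrite /= addNr sign_change0 => <-.
Qed.

Definition orbi_one := OrbiPath orbi_one_subproof.
Definition orbi_mul f k := OrbiPath (orbi_mul_subproof f k).
Definition orbi_inv f := OrbiPath (orbi_inv_subproof f).

Definition orbg_mul (a b : orbifold_group) : orbifold_group :=
  orbi_class (orbi_mul (repr a) (repr b)).
Definition orbg_inv (a : orbifold_group) : orbifold_group :=
  orbi_class (orbi_inv (repr a)).

Lemma orbi_classP f k : orbi_class f = orbi_class k <->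
  orbi_sign f = orbi_sign k /\ homotopic Z (orbi_fun f) (orbi_fun k).
Proof.
split=> [/eqP|[sfk fk]].
  by rewrite /orbi_class eqmodE => /andP[/eqP ? /asboolP].
by apply/eqP; rewrite /orbi_class eqmodE; apply/andP; split; [apply/eqP|apply/asboolP].
Qed.

Lemma orbi_classK (a : orbifold_group) : orbi_class (repr a) = a.
Proof. exact: reprK. Qed.

Lemma orbg_mulE f k :
  orbg_mul (orbi_class f) (orbi_class k) = orbi_class (orbi_mul f k).
Proof.
have /orbi_classP[sf hf] := orbi_classK (orbi_class f).
have /orbi_classP[sk hk] := orbi_classK (orbi_class k).
apply/orbi_classP; rewrite /= sf sk; split=> //.
have pf := orbi_pathP (repr (orbi_class f)); rewrite sf in pf.
have pk := orbi_pathP (repr (orbi_class k)); rewrite sk in pk.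
apply: (homotopic_cat pf (orbi_pathP f)) hf _.
- exact: is_path_sign pk.
- exact: is_path_sign (orbi_pathP k).
- exact: homotopic_sign.
Qed.

Let mulA : associative orbg_mul.
Proof.
move=> a b c; rewrite -(orbi_classK a) -(orbi_classK b) -(orbi_classK c) !orbg_mulE.
move: (repr a) (repr b) (repr c) => f g h.
apply/orbi_classP; split; first exact: addrA.
rewrite /= comp_path_cat sign_changeD.
apply: homotopic_catA (orbi_pathP f) (is_path_sign _ (orbi_pathP g)) _.
exact: is_path_sign (is_path_sign _ (orbi_pathP h)).
Qed.

Let mul1 : left_id (orbi_class orbi_one) orbg_mul.
Proof.
move=> a; rewrite -(orbi_classK a) orbg_mulE.
apply/orbi_classP; split; first exact: add0r.
rewrite /= sign_change0; apply: homotopic_cst_cat; exact: orbi_pathP.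
Qed.

Let mulr1 : right_id (orbi_class orbi_one) orbg_mul.
Proof.
move=> a; rewrite -(orbi_classK a) orbg_mulE.
apply/orbi_classP; split; first exact: addr0.
exact: (homotopic_cat_cst (orbi_pathP (repr a))).
Qed.

Let mulV : left_inverse (orbi_class orbi_one) orbg_inv orbg_mul.
Proof.
move=> a; rewrite -[X in orbg_mul _ X](orbi_classK a) orbg_mulE.
apply/orbi_classP; split; first exact: addNr.
have pf := orbi_pathP (repr a).
rewrite /= -comp_path_cat.
have := homotopic_sign (- orbi_sign (repr a)) (homotopic_rev_cat pf).
apply: homotopic_eq => // s _ /=.
have := congr1 (@^~ z0) (sign_changeD (R := R) (- orbi_sign (repr a)) (orbi_sign (repr a))).
by rewrite /= addNr sign_change0 => <-.
Qed.

Let mulrV : right_inverse (orbi_class orbi_one) orbg_inv orbg_mul.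
Proof.
move=> a; rewrite -[X in orbg_mul X _](orbi_classK a) orbg_mulE.
apply/orbi_classP; split; first exact: addrN.
have pf := orbi_pathP (repr a).
have -> : orbi_fun (orbi_mul (repr a) (orbi_inv (repr a))) =
    path_cat (orbi_fun (repr a)) (path_rev (orbi_fun (repr a))).
  congr path_cat; rewrite -[LHS]/((sign_change _ \o sign_change _) \o _).
  by rewrite -sign_changeD addrN sign_change0.
exact: homotopic_cat_rev pf.
Qed.

HB.instance Definition _ :=
  isGroup.Build orbifold_group mulA mul1 mulr1 mulV mulrV.

(* For a base point z over the interior of P, the generator given by the      *)
(* reflection in the i-th facet: go from z, inside the copy of P contained in *)
(* the positive orthant, to a point of the facet, and come back along the     *)
(* mirror image of the same path.                                             *)
Definition facet_reflection (i : 'I_n) (c : orbifold_group) : Prop :=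
  exists (q : 'rV[R]_n) (gamma : R -> 'rV[R]_n) (f : orbi_path),
  [/\ is_path (Z `&` orthant) z0 q gamma, q 0 i = 0,
      orbi_sign f = delta_mx 0 i,
      orbi_fun f =
        path_cat gamma (path_rev (sign_change (delta_mx 0 i) \o gamma)) &
      c = orbi_class f].

End OrbifoldGroup.

Section Presentations.
Context {I : Type}.

(* (i, false) stands for x_i and (i, true) for its formal inverse *)
Definition word := seq (I * bool).

Definition word_sq (i : I) : word := [:: (i, false); (i, false)].

Definition word_comm (i j : I) : word :=
  [:: (i, true); (j, true); (i, false); (j, false)].

Definition eval_word (G : groupType) (x : I -> G) (w : word) : G :=
  (\prod_(l <- w) (if l.2 then (x l.1)^-1 else x l.1))%g.

Inductive presented_eq (rels : set word) : word -> word -> Prop :=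
| PresRefl w : presented_eq rels w w
| PresSym u v : presented_eq rels u v -> presented_eq rels v u
| PresTrans u v w :
    presented_eq rels u v -> presented_eq rels v w -> presented_eq rels u w
| PresCat u u' v v' :
    presented_eq rels u u' -> presented_eq rels v v' ->
    presented_eq rels (u ++ v) (u' ++ v')
| PresCancel i b : presented_eq rels [:: (i, b); (i, ~~ b)] [::]
| PresRel r : rels r -> presented_eq rels r [::].

(* x induces an isomorphism from < I | rels > onto G *)
Definition has_presentation (G : groupType) (x : I -> G) (rels : set word) :=
  (forall g : G, exists w, eval_word x w = g) /\
  (forall u v, eval_word x u = eval_word x v <-> presented_eq rels u v).

End Presentations.
Arguments word : clear implicits.

Section Polytopes.
Context {R : realType} {n : nat}.
Implicit Types (P S F L : set 'rV[R]_n).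

Definition affine_subspace (d : nat) L := exists (p : 'rV[R]_n)
  (V : {vspace 'rV[R]_n}), L = [set x | x - p \in V] /\ \dim V = d.

Definition affine_hull S : set 'rV[R]_n :=
  [set x | exists (k : nat) (a : 'I_k -> R) (y : 'I_k -> 'rV[R]_n),
    [/\ forall i, S (y i), \sum_i a i = 1 & x = \sum_i a i *: y i]].

Definition convex_hull S : set 'rV[R]_n :=
  [set x | exists (k : nat) (a : 'I_k -> R) (y : 'I_k -> 'rV[R]_n),
    [/\ forall i, S (y i), forall i, 0 <= a i, \sum_i a i = 1 &
        x = \sum_i a i *: y i]].

Definition polytope P := exists2 S, finite_set S & P = convex_hull S.

Definition affine_dim (d : nat) S := affine_subspace d (affine_hull S).

Definition is_face P F := exists (c : 'rV[R]_n) (b : R),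
  (forall x, P x -> \sum_i c 0 i * x 0 i <= b) /\
  F = P `&` [set x | \sum_i c 0 i * x 0 i = b].

Definition is_facet P F :=
  is_face P F /\ exists2 d, affine_dim d.+1 P & affine_dim d F.

Definition is_vertex P (v : 'rV[R]_n) := is_face P [set v].

Definition coordinate_section P (i : 'I_n) : set 'rV[R]_n :=
  P `&` [set x | x 0 i = 0].

Definition geometrically_embedded P := polytope P /\
  exists (L : set 'rV[R]_n) (d : nat),
  [/\ affine_subspace d L, affine_dim d P,
      L `<=` [set x | \sum_i x 0 i = 1] & P = L `&` orthant] /\
  [/\ injective (coordinate_section P) &
      forall F, is_facet P F <-> exists i, F = coordinate_section P i].

End Polytopes.

(* vertices A, ..., F are 0, ..., 5; the i-th entry lists the vertices of the *)
(* facet numbered i + 1                                                       *)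
Definition octahedron_facets : seq (seq nat) :=
  let A := 0%N in let B := 1%N in let C := 2%N in
  let D := 3%N in let E := 4%N in let F := 5%N in
  [:: [:: A; B; C]; [:: A; B; D]; [:: A; D; E]; [:: A; C; E];
      [:: B; D; F]; [:: B; C; F]; [:: C; E; F]; [:: D; E; F]].

(* P is a 3-polytope with the vertex-facet incidences, hence the face lattice,*)
(* of the octahedron, its facet numbered i + 1 being the section by the i-th  *)
(* coordinate hyperplane (ordinals are counted from 0).                       *)
Definition octahedron (R : realType) (P : set 'rV[R]_8) := affine_dim 3 P /\
  exists v : 'I_6 -> 'rV[R]_8,
  [/\ injective v, range v = [set u | is_vertex P u] &
      forall (i : 'I_8) (a : 'I_6), coordinate_section P i (v a) <->
        (a : nat) \in nth [::] octahedron_facets i].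

Definition adjacent_facets : seq (nat * nat) :=
  [:: (1, 2); (2, 3); (3, 4); (4, 1); (5, 6); (6, 7); (7, 8); (8, 5);
      (1, 6); (2, 5); (3, 8); (4, 7)]%N.

Definition vertex_facets : seq (nat * nat) :=
  [:: (1, 3); (2, 4); (5, 7); (6, 8); (1, 7); (4, 6); (1, 5); (2, 6);
      (3, 7); (4, 8); (3, 8); (4, 7); (3, 5); (2, 8)]%N.

Definition octahedron_relators : set (word 'I_8) :=
  [set w | (exists i : 'I_8, w = word_sq i) \/
    (exists i j : 'I_8, ((i.+1, j.+1) \in adjacent_facets \/
                  (i.+1, j.+1) \in vertex_facets) /\ w = word_comm i j)].

(* Main.v *)
Require Import Defs.
From HB Require Import structures.
From mathcomp Require Import all_boot all_order all_algebra.
From mathcomp Require Import ring lra zify.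
From mathcomp Require Import all_classical all_reals all_analysis.

Set Implicit Arguments.
Unset Strict Implicit.
Unset Printing Implicit Defensive.

Import Order.TTheory GRing.Theory Num.Theory.
Import numFieldNormedType.Exports.

Local Open Scope classical_set_scope.
Local Open Scope ring_scope.

(* The only facets of the octahedron without a common point are the four      *)
(* pairs of opposite ones, so the presented group is the product of four      *)
(* infinite dihedral groups, and the kernel of its map to (Z/2)^8 is Z^4.     *)
(*                                                                            *)
(* Generators and relations: in the coordinates x_i |x_i|, Z(P) is the union  *)
(* of the 2^8 mirror images of the convex set P, hence locally star-shaped,   *)
(* and every path is homotopic to a chain of segments inside these chambers.  *)
(* Crossing from a chamber to another at a point q is a product of            *)
(* reflections in the facets through q; the reflection in a facet does not    *)
(* depend on the point of the facet where it is made, and reflections at a    *)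
(* common point commute.                                                      *)
(*                                                                            *)
(* Faithfulness: if i and j are opposite facets then (x_i, x_j) never         *)
(* vanishes on Z(P), and its variation of angle along a path, a homotopy      *)
(* invariant, determines the element of the corresponding dihedral group.     *)
(* For loops the four winding numbers give the isomorphism with Z^4.          *)

(** * Vertices of faces of polytopes *)

(** An element of the orbifold group is described by four integers, one for each pair of opposite
    facets, and these are computed in two ways.

    On the side of words, generators from different pairs commute, so modulo the relators a word is
    determined by where each infinite dihedral factor sends the chamber 0 of its line
    ([chamber_eqv]). On the side of paths, [opposite_facets_disjoint] keeps each projection to a
    plane (x_i, x_j) away from the origin. A continuous choice of angle over a square
    ([polar_lift_homotopy], [winding_homotopy]) makes the variation of angle a homotopy invariant,
    and it tells in which quadrant, counted with turns, a path ends. By [word_quadrant] the quadrant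
    number of a product of reflections is the chamber number of its word. Equal group elements
    therefore come from equivalent words ([eval_word_inj]). The relators hold because mirrors at one
    point multiply like sign changes ([mirrorM]), and [orbifold_group_generated] shows that the
    reflections generate.

    For a loop all signs are trivial, so its quadrant numbers are 4q with variation of angle 2 pi q.
    The four integers q determine the loop up to homotopy ([loop_homotopic_wind]) and take all
    values ([loop_with_wind]). A base point on a wall is handled by folding the loop with a sign
    change and joining it to an interior base point ([based_loop]). *)

Section PolytopeVertices.
Context {R : realType} {n : nat}.
Implicit Types (x y q : 'rV[R]_n) (s : seq 'rV[R]_n) (P S : set 'rV[R]_n).

Let dot x y : R := \sum_l x 0 l * y 0 l.

Lemma seq_argmax (T : eqType) (f : T -> R) (a : T) (s : seq.seq T) :
  exists2 q : T, q \in a :: s & forall x : T, x \in a :: s -> f x <= f q.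
Proof.
elim: s a => [|b s IH] a.
  by exists a; rewrite ?mem_head// => x; rewrite inE => /eqP->.
have [q qs qmax] := IH b.
have [aq|qa] := leP (f a) (f q).
  by exists q; [rewrite inE qs orbT|move=> x; rewrite inE => /orP[/eqP->//|/qmax]].
exists a; first by rewrite mem_head.
by move=> x; rewrite inE => /orP[/eqP->//|/qmax /le_trans]; apply; exact: ltW.
Qed.

(** Supplies the weight of the penalty term in [vertex_in_coordinate_face]: a finite list admits one
    M that works for all its points. *)
Lemma seq_dominate (T : eqType) (b c : T -> R) (p : pred T) (s : seq T) :
  (forall x : T, x \in s -> p x -> 0 < c x) ->
  exists M, forall x : T, x \in s -> p x -> b x < M * c x.
Proof.
elim: s => [|a s IH] c0; first by exists 0.
have [|M HM] := IH; first by move=> x xs; apply: c0; rewrite inE xs orbT.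
exists (Num.max M (b a / c a + 1)) => x; rewrite inE => /orP[/eqP->|xs] px.
  have ca : 0 < c a by apply: c0; rewrite ?mem_head.
  apply: (@lt_le_trans _ _ ((b a / c a + 1) * c a)).
    by rewrite mulrDl divfK ?gt_eqF// mul1r ltrDl.
  by rewrite ler_pM2r// le_max lexx orbT.
have cx : 0 < c x by apply: c0; rewrite ?inE ?xs ?orbT.
by apply: (lt_le_trans (HM _ xs px)); rewrite ler_pM2r// le_max lexx.
Qed.

Lemma dot_comb m x (a : 'I_m -> R) (y : 'I_m -> 'rV[R]_n) :
  dot x (\sum_k a k *: y k) = \sum_k a k * dot x (y k).
Proof.
rewrite /dot; under eq_bigr do rewrite summxE mulr_sumr.
rewrite exchange_big /=; apply: eq_bigr => k _; rewrite mulr_sumr.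
by apply: eq_bigr => l _; rewrite mxE mulrCA.
Qed.

Lemma convex_hull_sub S : S `<=` convex_hull S.
Proof.
move=> x Sx; exists 1%N, (fun=> 1), (fun=> x).
by split=> //; rewrite big_ord1 ?scale1r.
Qed.

(** A convex combination that attains the maximum of the form gives weight zero to every generator
    at which the form is strictly smaller. *)
Lemma exposed_vertex s c q : q \in s ->
  (forall x, x \in s -> x != q -> dot c x < dot c q) ->
  is_vertex (convex_hull [set` s]) q.
Proof.
move=> qs cq; have cq' x : x \in s -> dot c x <= dot c q.
  by move=> xs; have [->//|/cq/ltW] := eqVneq x q; exact.
exists c, (dot c q); split=> [x [m [a [y [ys a0 a1 ->]]]]|].
  rewrite -/(dot c _) dot_comb -[leRHS]mul1r -a1 mulr_suml; apply: ler_sum => k _.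
  by apply: ler_wpM2l => //; apply: cq'; exact: ys.
apply/seteqP; split=> [x ->|x [[m [a [y [ys a0 a1 xE]]]] /=]].
  by split=> //; exact: (convex_hull_sub qs).
rewrite -/(dot c _) xE dot_comb => /esym/eqP.
rewrite -[X in X == _]mul1r -a1 mulr_suml -subr_eq0 -sumrB => /eqP e.
have F0 k : true -> 0 <= a k * dot c q - a k * dot c (y k).
  by rewrite -mulrBr mulr_ge0// subr_ge0; apply: cq'; exact: ys.
rewrite -[RHS]scale1r -a1 scaler_suml; apply: eq_bigr => k _.
have [->|yq] := eqVneq (y k) q; first by [].
have /eqP : a k * dot c q - a k * dot c (y k) = 0 by exact: (psumr_eq0P F0 e).
rewrite -mulrBr mulf_eq0 => h.
suff /eqP -> : a k == 0 by rewrite !scale0r.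
case/orP: h => //.
by rewrite subr_eq0 gt_eqF// cq//; exact: ys.
Qed.

(* Among the points of S on the face, one of maximal norm, say q, is exposed  *)
(* by the form <q, x> - M (x_i + x_j) for M large.                            *)
Lemma vertex_in_coordinate_face P (i j : 'I_n) x : polytope P -> P `<=` orthant ->
  P x -> x 0 i = 0 -> x 0 j = 0 ->
  exists v, [/\ is_vertex P v, v 0 i = 0 & v 0 j = 0].
Proof.
move=> [S /finite_seqP[s ->] ->] PO [m [a [y [ys a0 a1 xE]]]] xi xj.
have s0 z l : z \in s -> 0 <= z 0 l by move=> zs; apply: PO; exact: convex_hull_sub.
have [k ak] : exists k, 0 < a k.
  apply: contrapT => /forallNP ak; suff : 1 <= 0 :> R by rewrite ler10.
  by rewrite -a1; apply: sumr_le0 => k _; rewrite leNgt; apply/negP; exact: ak.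
have yk l : x 0 l = 0 -> y k 0 l = 0.
  rewrite xE summxE => e.
  have F0 k' : true -> 0 <= (a k' *: y k') 0 l.
    by rewrite mxE mulr_ge0//; apply: s0; exact: ys.
  have /eqP : (a k *: y k) 0 l = 0 by exact: (psumr_eq0P F0 e).
  by rewrite mxE mulf_eq0 gt_eqF//= => /eqP.
pose s1 := [seq z : 'rV[R]_n <- s | (z 0 i == 0) && (z 0 j == 0)].
have : y k \in s1 by rewrite mem_filter (yk i)// (yk j)// !eqxx; exact: ys.
case es1 : s1 => [//|b s2] _.
have [q] := seq_argmax (fun z => dot z z) b s2.
rewrite -es1 => qs1 qmax.
have : q \in s1 by [].
rewrite mem_filter => /andP[/andP[/eqP qi /eqP qj] qs].
have [|M HM] := @seq_dominate _ (fun z => dot q z - dot q q) (fun z => z 0 i + z 0 j)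
    (fun z => z \notin s1) s.
  move=> z zs; rewrite mem_filter zs andbT negb_and => h.
  have zi := s0 z i zs; have zj := s0 z j zs.
  rewrite lt_neqAle addr_ge0// andbT eq_sym paddr_eq0// negb_and; exact: h.
exists q; split=> //.
apply: (@exposed_vertex s (q - M *: (delta_mx 0 i + delta_mx 0 j))) => // z zs zq.
have dE w : dot (q - M *: (delta_mx 0 i + delta_mx 0 j)) w = dot q w - M * (w 0 i + w 0 j).
  rewrite /dot; under eq_bigr do rewrite !mxE mulrBl -mulrA.
  rewrite sumrB -mulr_sumr; congr (_ - M * _).
  under eq_bigr do rewrite mulrDl.
  rewrite big_split/= (bigD1 i)//= (bigD1 j (P := xpredT))//= !eqxx !mul1r.
  rewrite !big1 ?addr0// => l /negbTE ->; rewrite ?andbF mul0r//.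
rewrite !dE qi qj addr0 mulr0 subr0.
have [zs1|zs1] := boolP (z \in s1); last by have := HM z zs zs1; lra.
move: (zs1); rewrite mem_filter => /andP[/andP[/eqP -> /eqP ->] _].
rewrite addr0 mulr0 subr0.
have d0 : 0 < dot (q - z) (q - z).
  rewrite lt_neqAle sumr_ge0 ?andbT; last by move=> l _; rewrite -expr2 sqr_ge0.
  rewrite eq_sym; apply: contraNneq zq => e.
  rewrite eq_sym -subr_eq0; apply/eqP/rowP => l.
  apply/eqP; rewrite [X in _ == X]mxE -sqrf_eq0 expr2; apply/eqP.
  have F0 l' : true -> 0 <= (q - z) 0 l' * (q - z) 0 l' by rewrite -expr2 sqr_ge0.
  exact: (psumr_eq0P F0 e).
have := qmax z zs1.
(* Since z is not q and has norm at most that of q, expanding |q - z|^2 > 0 gives <q, z> < <q,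
   q>. *)
have dd : dot (q - z) (q - z) = dot q q + dot z z - 2 * dot q z.
  rewrite /dot -big_split/= mulr_sumr -sumrB; apply: eq_bigr => l _; rewrite !mxE; ring.
by rewrite dd in d0 => /= ?; lra.
Qed.

End PolytopeVertices.

(** * Normal forms of words *)

Section OctahedronWords.
Implicit Types (i j : 'I_8) (k l : 'I_4) (n : int) (u v w : word 'I_8).
Local Notation eqv := (presented_eq octahedron_relators).

(* The facets numbered i + 1 and 8 - i are opposite; k runs over the pairs of *)
(* opposite facets.                                                           *)
Definition lo k : 'I_8 := lshift 4 k.
Definition hi k : 'I_8 := rev_ord (lo k).

Lemma lo_or_hi i : exists k, i = lo k \/ i = hi k.
Proof.
case: i => i i8; have [i4|i4] := ltnP i 4.
  by exists (Ordinal i4); left; exact: val_inj.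
have h : (7 - i < 4)%N by lia.
by exists (Ordinal h); right; apply: val_inj => /=; lia.
Qed.

Lemma lo_neq_hi k l : (lo k == hi l) = false.
Proof. by apply/negbTE/eqP => /(congr1 val) /=; case: k l => k ? [l ?] /=; lia. Qed.

Lemma lo_eq k l : (lo k == lo l) = (k == l).
Proof. by apply/eqP/eqP => [/(congr1 val) /= e|->//]; exact: val_inj. Qed.

Lemma hi_eq k l : (hi k == hi l) = (k == l).
Proof. by rewrite /hi (inj_eq rev_ord_inj) lo_eq. Qed.

Lemma eqv_catl u v v' : eqv v v' -> eqv (u ++ v) (u ++ v').
Proof. by move=> e; apply: PresCat => //; exact: PresRefl. Qed.

Lemma eqv_catr u u' v : eqv u u' -> eqv (u ++ v) (u' ++ v).
Proof. by move=> e; apply: PresCat => //; exact: PresRefl. Qed.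

Lemma eqv_sq i : eqv [:: (i, false); (i, false)] [::].
Proof. by apply: PresRel; left; exists i. Qed.

Lemma eqv_letter i b : eqv [:: (i, b)] [:: (i, false)].
Proof.
case: b; last exact: PresRefl.
apply: (@PresTrans _ _ _ ([:: (i, true)] ++ [:: (i, false); (i, false)])).
  apply/PresSym; rewrite -[X in eqv _ X]cats0; apply: eqv_catl; exact: eqv_sq.
exact: (@eqv_catr [:: (i, true); (i, false)] [::] _ (PresCancel _ i true)).
Qed.

Lemma relator_comm i j : octahedron_relators (word_comm i j) ->
  eqv [:: (i, false); (j, false)] [:: (j, false); (i, false)].
Proof.
move=> r; apply: PresSym.
apply: (@PresTrans _ _ _ ([:: (j, false); (i, false)] ++ word_comm i j)).
  rewrite -[X in eqv X _]cats0; apply: eqv_catl; apply: PresSym; exact: PresRel.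
apply: (@PresTrans _ _ _ ([:: (j, false)] ++ [:: (j, true); (i, false); (j, false)])).
  apply: (@eqv_catl [:: (j, false)]).
  exact: (@eqv_catr [:: (i, false); (i, true)] [::] _ (PresCancel _ i false)).
exact: (@eqv_catr [:: (j, false); (j, true)] [::] _ (PresCancel _ j false)).
Qed.

Lemma eqv_comm i j : rev_ord i != j ->
  eqv [:: (i, false); (j, false)] [:: (j, false); (i, false)].
Proof.
have [->|ij] := eqVneq i j; first by move=> _; exact: PresRefl.
move=> rij.
pose R (a b : nat) := ((a.+1, b.+1) \in adjacent_facets) || ((a.+1, b.+1) \in vertex_facets).
have : R i j || R j i.
  (* Exhaustive check; the lists record unordered pairs, so both orders are tried. *)
  have : all (fun a => all (fun b => [|| a == b, a + b == 7, R a b | R b a]%N) (iota 0 8)) (iota 0 8) by [].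
  move=> /allP /(_ i); rewrite mem_iota => /(_ (ltn_ord i)) /allP /(_ j).
  rewrite mem_iota => /(_ (ltn_ord j)) /or3P[/eqP e|/eqP e|//].
    by move/eqP: ij; case; exact: val_inj.
  by move/eqP: rij; case; apply: val_inj => /=; lia.
case/orP => /orP r; [|apply: PresSym]; apply: relator_comm; right.
  by exists i, j.
by exists j, i.
Qed.

Fixpoint alternating i j (m : nat) : word 'I_8 :=
  if m is m'.+1 then (i, false) :: alternating j i m' else [::].

(* The elements of the infinite dihedral group generated by lo k and hi k are *)
(* numbered by the chambers [n, n + 1] of the line: lo k is the reflection    *)
(* n |-> 1 - n in the point 1 and hi k the reflection n |-> -1 - n in 0.      *)
Definition dihedral_word k n : word 'I_8 :=
  match n with
  | Posz m => alternating (lo k) (hi k) m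
  | Negz m => alternating (hi k) (lo k) m.+1
  end.

Definition chamber_step k i n : int :=
  if i == lo k then 1 - n else if i == hi k then -1 - n else n.

(** The last letter acts first, so that concatenation becomes composition. The inversion flag is
    ignored because the generators are involutions. *)
Definition chamber k w n : int := foldr (fun x => chamber_step k x.1) n w.

Lemma chamber_cat k u v n : chamber k (u ++ v) n = chamber k u (chamber k v n).
Proof. exact: foldr_cat. Qed.

Lemma eqv_cancel i w : eqv [:: (i, false), (i, false) & w] w.
Proof. exact: (@eqv_catr [:: (i, false); (i, false)] [::] _ (eqv_sq i)). Qed.

(** For n > 0 the word starts with [lo k] and the new letter cancels it; for n <= 0 the new letter
    prolongs the alternation. *)
Lemma dihedral_word_lo k n :
  eqv ((lo k, false) :: dihedral_word k n) (dihedral_word k (1 - n)).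
Proof.
case: n => [[|m]|m]; first exact: PresRefl.
  rewrite (_ : 1 - _ = - (m%:Z)); last by lia.
  by case: m => [|m]; rewrite -?NegzE; exact: eqv_cancel.
by rewrite NegzE (_ : 1 - _ = m.+2%:Z); [exact: PresRefl|rewrite ?NegzE; lia].
Qed.

Lemma dihedral_word_hi k n :
  eqv ((hi k, false) :: dihedral_word k n) (dihedral_word k (-1 - n)).
Proof.
case: n => [m|m].
  by rewrite (_ : -1 - _ = Negz m); [exact: PresRefl|rewrite ?NegzE; lia].
rewrite NegzE (_ : -1 - _ = m%:Z); last by lia.
exact: eqv_cancel.
Qed.

Lemma eqv_comm_alternating i j j' m : rev_ord i != j -> rev_ord i != j' ->
  eqv ((i, false) :: alternating j j' m) (alternating j j' m ++ [:: (i, false)]).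
Proof.
elim: m j j' => [|m IH] j j' ij ij' /=; first exact: PresRefl.
apply: (@PresTrans _ _ _ [:: (j, false), (i, false) & alternating j' j m]).
  exact: (@eqv_catr _ _ (alternating j' j m) (eqv_comm ij)).
exact: (@eqv_catl [:: (j, false)] _ _ (IH _ _ ij' ij)).
Qed.

Lemma eqv_comm_dihedral i k n : i != lo k -> i != hi k ->
  eqv ((i, false) :: dihedral_word k n) (dihedral_word k n ++ [:: (i, false)]).
Proof.
move=> nl nh.
have rl : rev_ord i != lo k.
  by rewrite -(inj_eq rev_ord_inj) rev_ordK.
have rh : rev_ord i != hi k by rewrite /hi (inj_eq rev_ord_inj).
by case: n => m; apply: eqv_comm_alternating.
Qed.

(** The list of factors is a parameter so that statements can be proved by induction on it; it is
    used at [enum 'I_4]. *)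
Definition normal_word (s : seq 'I_4) (n : 'I_4 -> int) : word 'I_8 :=
  flatten [seq dihedral_word k (n k) | k <- s].

Lemma eqv_normal_step (s : seq 'I_4) (n : 'I_4 -> int) i k : uniq s -> k \in s ->
  i = lo k \/ i = hi k ->
  eqv ((i, false) :: normal_word s n) (normal_word s (fun l => chamber_step l i (n l))).
Proof.
move=> + + ik.
have other l : l != k -> (i != lo l) * (i != hi l).
  by move=> lk; case: ik => ->; rewrite ?[hi k == lo l]eq_sym ?lo_eq ?hi_eq ?lo_neq_hi eq_sym lk.
elim: s => //= l s IH /andP[ls us]; rewrite in_cons => /orP[/eqP kl|ks].
  subst l; rewrite /normal_word /= -cat_cons.
  have -> : [seq dihedral_word l (chamber_step l i (n l)) | l <- s] =
            [seq dihedral_word l (n l) | l <- s].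
    apply/eq_in_map => l ls'; rewrite /chamber_step.
    have lk : l != k by apply: contraNneq ls => <-.
    by have [/negbTE -> /negbTE ->] := other _ lk.
  apply: eqv_catr; rewrite /chamber_step; case: ik => ->; rewrite eqxx.
    exact: dihedral_word_lo.
  by rewrite eq_sym lo_neq_hi; exact: dihedral_word_hi.
have lk : l != k by apply: contraNneq ls => ->.
have [nl nh] := other _ lk.
rewrite /normal_word /= -cat_cons.
apply: (@PresTrans _ _ _ ((dihedral_word l (n l) ++ [:: (i, false)]) ++ normal_word s n)).
  by apply: eqv_catr; exact: eqv_comm_dihedral.
have -> : chamber_step l i (n l) = n l by rewrite /chamber_step (negbTE nl) (negbTE nh).
by rewrite -catA; apply: eqv_catl; exact: IH.
Qed.

Lemma eqv_normal_word w :
  eqv w (normal_word (enum 'I_4) (fun k => chamber k w 0)).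
Proof.
elim: w => [|[i b] w IH] /=.
  rewrite (_ : normal_word _ _ = [::]); first exact: PresRefl.
  by rewrite /normal_word; elim: (enum 'I_4).
have [k ik] := lo_or_hi i.
apply: (@PresTrans _ _ _ ((i, false) :: w)).
  exact: (@eqv_catr [:: (i, b)] _ w (eqv_letter i b)).
apply: (@PresTrans _ _ _ ((i, false) :: normal_word (enum 'I_4) (fun k => chamber k w 0))).
  exact: (@eqv_catl [:: (i, false)]).
by apply: eqv_normal_step ik => //; rewrite ?enum_uniq ?mem_enum.
Qed.

Lemma chamber_eqv u v : (forall k, chamber k u 0 = chamber k v 0) -> eqv u v.
Proof.
move=> uv; apply: PresTrans (eqv_normal_word u) _.
rewrite (_ : (fun k => chamber k u 0) = (fun k => chamber k v 0)).
  exact/PresSym/eqv_normal_word.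
exact/funext.
Qed.

Lemma chamber_dihedral k n : chamber k (dihedral_word k n) 0 = n.
Proof.
have alt m : chamber k (alternating (lo k) (hi k) m) 0 = m /\
    chamber k (alternating (hi k) (lo k) m) 0 = - m%:Z.
  elim: m => //= m [IH1 IH2]; rewrite IH1 IH2 /chamber_step !eqxx.
  by rewrite [hi k == lo k]eq_sym lo_neq_hi; split; lia.
by case: n => m; have [? ?] := alt m; have [? h] := alt m.+1; rewrite /= -/(chamber _ _ _)// NegzE -h.
Qed.

Lemma chamber_dihedral_neq k l n m : k != l -> chamber k (dihedral_word l n) m = m.
Proof.
move=> kl.
have stl : chamber_step k (lo l) m = m.
  by rewrite /chamber_step lo_eq lo_neq_hi eq_sym (negbTE kl).
have sth : chamber_step k (hi l) m = m.
  by rewrite /chamber_step hi_eq eq_sym lo_neq_hi eq_sym (negbTE kl).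
have alt p : chamber k (alternating (lo l) (hi l) p) m = m /\
    chamber k (alternating (hi l) (lo l) p) m = m.
  by elim: p => //= p [IH1 IH2]; rewrite IH1 IH2 stl sth.
by case: n => p; [have [] := alt p|have [] := alt p.+1].
Qed.

Lemma chamber_normal k (n : 'I_4 -> int) :
  chamber k (normal_word (enum 'I_4) n) 0 = n k.
Proof.
have : uniq (enum 'I_4) by exact: enum_uniq.
have : k \in enum 'I_4 by rewrite mem_enum.
have notin s : k \notin s -> chamber k (normal_word s n) 0 = 0.
  elim: s => //= l s IH; rewrite in_cons negb_or => /andP[kl ks].
  by rewrite /normal_word /= chamber_cat chamber_dihedral_neq// IH.
elim: (enum 'I_4) => //= l s IH; rewrite in_cons => /orP[/eqP<- /andP[ks _]|ks /andP[ls us]].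
  by rewrite /normal_word /= chamber_cat notin// chamber_dihedral.
by rewrite /normal_word /= chamber_cat IH// chamber_dihedral_neq//; apply: contraNneq ls => <-.
Qed.
End OctahedronWords.

(** * Winding of plane paths *)

Section Angles.
Context {R : realType}.
Implicit Types (a b r s t u v : R).
Local Notation I := (unit_interval : set R).
Local Notation II := (unit_interval `*` unit_interval : set (R * R)).

Definition polar th u v := exists2 r, 0 < r & u = r * cos th /\ v = r * sin th.

Lemma polar_exists u v : 0 < u ^+ 2 + v ^+ 2 -> exists th, polar th u v.
Proof.
move=> uv; set r := Num.sqrt (u ^+ 2 + v ^+ 2).
have r0 : 0 < r by rewrite sqrtr_gt0.
have r2 : r ^+ 2 = u ^+ 2 + v ^+ 2 by rewrite sqr_sqrtr// ltW.
have bnd : -1 <= u / r <= 1.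
  by rewrite ler_pdivlMr// ler_pdivrMr//; apply/andP; split; nra.
have sq : r * sin (acos (u / r)) = `|v|.
  have rE : r = Num.sqrt (r ^+ 2) by rewrite sqrtr_sqr gtr0_norm.
  rewrite sin_acos// [X in X * _]rE -sqrtrM ?sqr_ge0// -sqrtr_sqr; congr Num.sqrt.
  by rewrite mulrBr mulr1 expr_div_n mulrCA divff ?expf_neq0 ?gt_eqF// mulr1 r2; ring.
have cq : r * cos (acos (u / r)) = u by rewrite acosK ?in_itv//= mulrC divfK// gt_eqF.
have [v0|v0] := leP 0 v.
  by exists (acos (u / r)); exists r => //; rewrite cq sq ger0_norm.
exists (- acos (u / r)); exists r => //.
by rewrite cosN sinN mulrN cq sq ltr0_norm// opprK.
Qed.

(** The oriented angle from (u, v) to (u', v'), as determinant over scalar product; it is correct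
    when the scalar product is positive. *)
Definition small_angle u v u' v' := atan ((u * v' - v * u') / (u * u' + v * v')).

Lemma polar_small_angle th u v u' v' : polar th u v -> 0 < u * u' + v * v' ->
  polar (th + small_angle u v u' v') u' v'.
Proof.
move=> [r r0 [eu ev]] d0; rewrite /small_angle.
set d := u * u' + v * v' in d0 *; set c := u * v' - v * u'.
set al := atan _.
have ca : 0 < cos al.
  by rewrite cos_atan invr_gt0 sqrtr_gt0 ltr_pwDl// sqr_ge0.
have sa : sin al = cos al * (c / d).
  rewrite -[c / d]atanK -/al /tan mulrC divfK// gt_eqF//.
have k0 : 0 < cos al / d * r by rewrite mulr_gt0// divr_gt0.
have cs := cos2Dsin2 th.
have dE : d = r * (cos th * u' + sin th * v') by rewrite /d eu ev; ring.
have cE : c = r * (cos th * v' - sin th * u') by rewrite /c eu ev; ring.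
exists (cos al / d * r)^-1; first by rewrite invr_gt0.
have key1 : cos (th + al) = cos al / d * r * u'.
  transitivity (cos al / d * (cos th * d - sin th * c)).
    by rewrite cosD sa; field; rewrite gt_eqF.
  rewrite dE cE -!mulrA; congr (_ * (_ * _)).
  transitivity (r * u' * (cos th ^+ 2 + sin th ^+ 2)); first by ring.
  by rewrite cs mulr1.
have key2 : sin (th + al) = cos al / d * r * v'.
  transitivity (cos al / d * (sin th * d + cos th * c)).
    by rewrite sinD sa; field; rewrite gt_eqF.
  rewrite {2}dE cE -!mulrA; congr (_ * (_ * _)).
  transitivity (r * v' * (cos th ^+ 2 + sin th ^+ 2)); first by ring.
  by rewrite cs mulr1.
by rewrite key1 key2 !mulKf// gt_eqF.
Qed.

(** Congruence modulo 2 pi is expressed throughout by a cosine equal to 1, which avoids naming the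
    integer multiple. *)
Lemma polar_inj th th' u v : polar th u v -> polar th' u v -> cos (th - th') = 1.
Proof.
move=> [r r0 [eu ev]] [r' r'0 [eu' ev']].
have rr : r = r'.
  apply/eqP; rewrite -(eqrXn2 (n := 2))// ?ltW//; apply/eqP.
  transitivity (u ^+ 2 + v ^+ 2).
    rewrite eu ev; transitivity (r ^+ 2 * (cos th ^+ 2 + sin th ^+ 2)); last by ring.
    by rewrite cos2Dsin2 mulr1.
  rewrite eu' ev'; transitivity (r' ^+ 2 * (cos th' ^+ 2 + sin th' ^+ 2)); first by ring.
  by rewrite cos2Dsin2 mulr1.
have rn : r != 0 by rewrite gt_eqF.
have c : cos th = cos th' by apply: (mulfI rn); rewrite -eu eu' rr.
have s : sin th = sin th' by apply: (mulfI rn); rewrite -ev ev' rr.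
by rewrite cosB c s -!expr2 cos2Dsin2.
Qed.

(** A continuous function whose increments are multiples of 2 pi cannot jump. As cos is injective on
    [0, pi], an increment of size at most pi vanishes. *)
Lemma cos_eq1_const (h : R -> R) : {within I, continuous h} ->
  (forall s, I s -> cos (h s - h 0) = 1) -> forall s, I s -> h s = h 0.
Proof.
move=> ch h1 s Is; apply/eqP/negPn/negP => hs.
have s01 : 0 <= s <= 1 by exact/IE.
have [s0 s1] := andP s01.
have sI : `[0, s]%classic `<=` I.
  by move=> x; rewrite /= in_itv/= => /andP[x0 xs]; apply/IE; rewrite x0/=; exact: le_trans s1.
have ch' := continuous_subspaceW sI ch.
have pi0 := pi_gt0 R.
have conc x : I x -> 0 <= `|h x - h 0| <= pi -> h x = h 0.
  move=> Ix b; apply/eqP; rewrite -subr_eq0 -normr_eq0; apply/eqP.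
  apply: cos_inj; rewrite ?in_itv//= ?lexx ?pi_ge0// cos0.
  by have [_|_] := ger0P (h x - h 0); rewrite ?cosN; exact: h1.
have [le|gt] := leP `|h s - h 0| pi.
  by move/eqP: hs; apply; apply: conc => //; rewrite normr_ge0.
(* A larger increment would force h through a value at distance exactly pi from [h 0], which [conc]
   excludes. *)
pose v := h 0 + (if h 0 <= h s then pi else - pi).
have [x + hx] : exists2 c, c \in `[0, s] & h c = v.
  apply: IVT => //; rewrite /v ge_min le_max.
  move: gt; have [?|?] := leP (h 0) (h s); [rewrite ger0_norm|rewrite ltr0_norm]; lra.
rewrite in_itv/= => xs; have Ix : I x by apply: sI; rewrite /= in_itv.
have : h x = h 0.
  apply: conc => //; rewrite hx /v addrC addKr.
  by case: ifP => _; rewrite ?normrN gtr0_norm// lexx ltW.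
rewrite hx /v; case: ifP => _ /eqP; rewrite -subr_eq0 addrC addKr ?oppr_eq0 ?gt_eqF//.
Qed.

Lemma compact_I : compact I.
Proof. exact: segment_compact. Qed.

Lemma compact_II : compact II.
Proof. by apply: compact_setX; exact: compact_I. Qed.

(** A Lebesgue number argument: positivity holds near each point of the compact diagonal, hence on a
    neighbourhood of uniform width. *)
Lemma positive_near_diagonal (F : R * R * (R * R) -> R) : continuous F ->
  (forall s p, I s -> II p -> 0 < F (s, s, p)) ->
  exists N : nat, forall s s' p, I s -> `|s - s'| <= N.+1%:R^-1 -> II p ->
    0 < F (s, s', p).
Proof.
move=> cF F0.
have /compact_near_coveringP cov : compact (I `*` II).
  by apply: compact_setX; [exact: compact_I|exact: compact_II].
have := cov nat \oo (fun N (x : R * (R * R)) => forall s', `|x.1 - s'| <= N.+1%:R^-1 ->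
   0 < F (x.1, s', x.2)) _.
case.
  move=> [s0 p0] [/= Is Ip].
  have : \forall z \near (s0, s0, p0), 0 < F z.
    exact: (cvgr_gt (F (s0, s0, p0)) (cF (s0, s0, p0)) 0 (F0 _ _ Is Ip)).
  move=> [[A B] [/= [[A1 A2] [/= nA1 nA2] sA] nB] AB].
  move/nbhs_ballP : nA2 => [e /= e0 eA2].
  have e20 : 0 < e / 2 by rewrite divr_gt0.
  exists ((A1 `&` ball s0 (e / 2)) `*` B, [set N | N.+1%:R^-1 < e / 2]) => /=.
    split; last exact: (near_infty_natSinv_lt (PosNum e20)).
    exists (A1 `&` ball s0 (e / 2), B) => //=; split => //.
    by apply: filterI => //; exact: (nbhsx_ballx s0 (e / 2) e20).
  move=> [[s p] N] /= [[[A1s sb] Bp] Ne] s' ss'.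
  apply: (AB (s, s', p)); split => //=; apply: sA; split => //=.
  apply: eA2; rewrite /ball/= (splitr e) (_ : s0 - s' = (s0 - s) + (s - s')); last by ring.
  apply: (le_lt_trans (ler_normD _ _)); apply: ltrD => //.
  exact: le_lt_trans Ne.
move=> N _ HN; exists N => s s' p Is ss' Ip.
by have := HN N (leqnn N) (s, p) (conj Is Ip) s' ss'.
Qed.

Lemma small_angle_continuous (T : topologicalType) (f g f' g' : T -> R) (x : T) :
  {for x, continuous f} -> {for x, continuous g} ->
  {for x, continuous f'} -> {for x, continuous g'} ->
  0 < f x * f' x + g x * g' x ->
  {for x, continuous (fun y => small_angle (f y) (g y) (f' y) (g' y))}.
Proof.
move=> cf cg cf' cg' d0.
apply: (@continuous_comp _ _ _ (fun y => (f y * g' y - g y * f' y) /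
  (f y * f' y + g y * g' y)) atan); last exact: continuous_atan.
apply: cvgM; first by apply: cvgB; apply: cvgM.
apply: cvgV; first by rewrite gt_eqF.
by apply: cvgD; apply: cvgM.
Qed.

(* By compactness, the segment from 0 to p can be cut into N.+1 pieces along  *)
(* which the direction turns by less than a right angle, with the same N for  *)
(* all p; the angle at p is the sum of these small angles, which are          *)
(* continuous in p.                                                           *)
Lemma polar_lift_square (G1 G2 : R * R -> R) : continuous G1 -> continuous G2 ->
  (forall p, II p -> 0 < G1 p ^+ 2 + G2 p ^+ 2) ->
  exists th : R * R -> R, {within II, continuous th} /\
    forall p, II p -> polar (th p) (G1 p) (G2 p).
Proof.
move=> c1 c2 G0.
pose sc (x : R * (R * R)) : R * R := (x.1 * x.2.1, x.1 * x.2.2).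
have csc : continuous sc.
  move=> x; apply: (@cvg_pair _ _ _ _ (nbhs _) (nbhs _)).
    apply: cvgM; first exact: cvg_fst.
    by apply: (@continuous_comp _ _ _ snd fst); [exact: cvg_snd|exact: cvg_fst].
  apply: cvgM; first exact: cvg_fst.
  by apply: (@continuous_comp _ _ _ snd snd); [exact: cvg_snd|exact: cvg_snd].
have Isc s p : I s -> II p -> II (sc (s, p)).
  by case: p => a b /IE ? [/= /IE ? /IE ?]; split; apply/IE => /=; nra.
pose F (x : R * R * (R * R)) := G1 (sc (x.1.1, x.2)) * G1 (sc (x.1.2, x.2)) +
  G2 (sc (x.1.1, x.2)) * G2 (sc (x.1.2, x.2)).
have csc1 : continuous (fun x : R * R * (R * R) => sc (x.1.1, x.2)).
  move=> x; apply: (@continuous_comp _ _ _ (fun x : R * R * (R * R) => (x.1.1, x.2)) sc); last exact: csc.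
  apply: (@cvg_pair _ _ _ _ (nbhs _) (nbhs _)); last exact: cvg_snd.
  by apply: (@continuous_comp _ _ _ fst fst); [exact: cvg_fst|exact: cvg_fst].
have csc2 : continuous (fun x : R * R * (R * R) => sc (x.1.2, x.2)).
  move=> x; apply: (@continuous_comp _ _ _ (fun x : R * R * (R * R) => (x.1.2, x.2)) sc); last exact: csc.
  apply: (@cvg_pair _ _ _ _ (nbhs _) (nbhs _)); last exact: cvg_snd.
  by apply: (@continuous_comp _ _ _ fst snd); [exact: cvg_fst|exact: cvg_snd].
have cF : continuous F.
  move=> x; apply: cvgD; apply: cvgM.
  - by apply: (@continuous_comp _ _ _ (fun x : R * R * (R * R) => sc (x.1.1, x.2)) G1); [exact: csc1|exact: c1].
  - by apply: (@continuous_comp _ _ _ (fun x : R * R * (R * R) => sc (x.1.2, x.2)) G1); [exact: csc2|exact: c1].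
  - by apply: (@continuous_comp _ _ _ (fun x : R * R * (R * R) => sc (x.1.1, x.2)) G2); [exact: csc1|exact: c2].
  - by apply: (@continuous_comp _ _ _ (fun x : R * R * (R * R) => sc (x.1.2, x.2)) G2); [exact: csc2|exact: c2].
have [|N HN] := positive_near_diagonal cF.
  by move=> s p Is Ip; rewrite /F /= -!expr2; apply: G0; exact: Isc.
pose q (k : nat) : R := k%:R / N.+1%:R.
have Iq k : (k <= N.+1)%N -> I (q k).
  move=> kN; apply/IE; rewrite /q divr_ge0//= ler_pdivrMr ?ltr0n// mul1r ler_nat//.
suff: forall k, (k <= N.+1)%N -> exists th : R * R -> R,
    forall p, II p -> {for p, continuous th} /\
      polar (th p) (G1 (sc (q k, p))) (G2 (sc (q k, p))).
  move=> /(_ N.+1 (leqnn _))[th Hth]; exists th; split.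
    apply/subspace_continuousP => p Ip; apply: cvg_within_filter.
    by have [] := Hth p Ip.
  move=> p Ip; have [_] := Hth p Ip.
  by rewrite /q divff ?pnatr_eq0// /sc /= !mul1r -surjective_pairing.
elim=> [_|k IH kN].
  have [th Hth] := polar_exists (G0 (0, 0) (conj I0 I0)).
  exists (fun=> th) => p Ip; split; first exact: cvg_cst.
  by rewrite /q mul0r /sc /= !mul0r.
have [th Hth] := IH (ltnW kN).
exists (fun p => th p + small_angle (G1 (sc (q k, p))) (G2 (sc (q k, p)))
   (G1 (sc (q k.+1, p))) (G2 (sc (q k.+1, p)))) => p Ip.
have [cth pth] := Hth p Ip.
have Fp : 0 < F (q k, q k.+1, p).
  apply: HN => //; first by apply: Iq; exact: ltnW.
  rewrite /q -mulrBl -[X in _ - X]natr1 opprD addNKr normrM normrN1 mul1r.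
  by rewrite ger0_norm// invr_ge0.
split; last exact: polar_small_angle.
have cG (G : R * R -> R) r : continuous G -> {for p, continuous (fun p => G (sc (r, p)))}.
  move=> cG; apply: (@continuous_comp _ _ _ (fun p => sc (r, p)) G); last exact: cG.
  apply: (@continuous_comp _ _ _ (fun p => (r, p)) sc); last exact: csc.
  by apply: (@cvg_pair _ _ _ _ (nbhs _) (nbhs _)); [exact: cvg_cst|exact: cvg_id].
apply: cvgD; first exact: cth.
by apply: small_angle_continuous => //; exact: cG.
Qed.

(** Retraction of the line onto the unit interval; composing with it turns maps continuous within
    the square into maps continuous on the whole plane. *)
Definition clamp s : R := Num.max 0 (Num.min s 1).

Lemma clamp_continuous : continuous clamp.
Proof.
move=> s; apply: (@continuous_max R R (fun=> 0) (fun s => Num.min s 1)); first exact: cvg_cst.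
by apply: (@continuous_min R R id (fun=> 1)); [exact: cvg_id|exact: cvg_cst].
Qed.

Lemma clamp_I s : I (clamp s).
Proof. by apply/IE; rewrite /clamp le_max lexx/= ge_max ler01 ge_min lexx orbT. Qed.

Lemma clampE s : I s -> clamp s = s.
Proof. by move=> /IE /andP[s0 s1]; rewrite /clamp min_l// max_r. Qed.

Lemma polar_shift th d u v : polar th u v -> cos d = 1 -> polar (th + d) u v.
Proof.
move=> [r r0 [eu ev]] cd.
have sd : sin d = 0.
  by apply/eqP; rewrite -sqrf_eq0 sin2cos2 cd expr1n subrr.
by exists r; rewrite // cosD sinD cd sd !mulr1 !mulr0 subr0 addr0.
Qed.

Implicit Types f g th : R -> R.

Definition angle_lift f g th :=
  {within I, continuous th} /\ forall s, I s -> polar (th s) (f s) (g s).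

(** Total variation of angle, not divided by 2 pi. It is 0 when there is no lift, by the default
    [fun=> 0]; [windingE] shows that any lift may be used. *)
Definition winding f g : R :=
  let th := xget (fun=> 0) [set th | angle_lift f g th] in th 1 - th 0.

Definition plane_path f g :=
  [/\ {within I, continuous f}, {within I, continuous g} &
      forall s, I s -> 0 < f s ^+ 2 + g s ^+ 2].

Lemma polar_lift_homotopy (H1 H2 : R * R -> R) :
  {within II, continuous H1} -> {within II, continuous H2} ->
  (forall p, II p -> 0 < H1 p ^+ 2 + H2 p ^+ 2) ->
  exists th : R * R -> R, {within II, continuous th} /\
    forall p, II p -> polar (th p) (H1 p) (H2 p).
Proof.
move=> c1 c2 H0.
pose c2d (p : R * R) : R * R := (clamp p.1, clamp p.2).
have cc : continuous c2d.
  move=> p; apply: (@cvg_pair _ _ _ _ (nbhs _) (nbhs _)).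
    by apply: (@continuous_comp _ _ _ fst clamp); [exact: cvg_fst|exact: clamp_continuous].
  by apply: (@continuous_comp _ _ _ snd clamp); [exact: cvg_snd|exact: clamp_continuous].
have Ic p : II (c2d p) by split; exact: clamp_I.
have cG (H : R * R -> R) : {within II, continuous H} -> continuous (H \o c2d).
  move=> cH; apply/continuous_subspace_setT.
  apply: (@within_comp _ _ _ setT II c2d H) => //; exact: continuous_subspaceT.
have [|th [cth pth]] := polar_lift_square (cG _ c1) (cG _ c2).
  by move=> p Ip; exact: H0.
exists th; split=> // -[s t] Ip; have := pth _ Ip.
by case: Ip => /= Is It; rewrite /c2d /= !clampE.
Qed.

Lemma angle_lift_exists f g : plane_path f g -> exists th, angle_lift f g th.
Proof.
move=> [cf cg p0].
have cF (k : R -> R) : {within I, continuous k} -> {within II, continuous (k \o fst)}.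
  move=> ck; apply: (@within_comp _ _ _ II I fst k) => //; last by move=> p [].
  by apply: continuous_subspaceT => p; exact: cvg_fst.
have [|th [cth pth]] := polar_lift_homotopy (cF _ cf) (cF _ cg).
  by move=> p [Ip _]; exact: p0.
exists (fun s => th (s, 0)); split; last by move=> s Is; apply: (pth (s, 0)); split => //; exact: I0.
apply: (@within_comp _ _ _ I II (fun s => (s, 0)) th) => //.
  apply: continuous_subspaceT => s.
  by apply: (@cvg_pair _ _ _ _ (nbhs _) (nbhs _)); [exact: cvg_id|exact: cvg_cst].
by move=> s Is; split => //; exact: I0.
Qed.

Lemma windingE f g th : angle_lift f g th -> winding f g = th 1 - th 0.
Proof.
move=> L; rewrite /winding; set th' := xget _ _.
have [cth' pth'] : angle_lift f g th' by apply: (@xgetPex _ _ [set th | angle_lift f g th]); exists th.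
have [cth pth] := L.
suff : th' 1 - th 1 = th' 0 - th 0 by move=> e; lra.
apply: (@cos_eq1_const (th' \- th)) I1.
  by move=> x; apply: cvgB; [exact: cth'|exact: cth].
move=> s Is /=; rewrite cosB.
have c s' : I s' -> cos (th' s' - th s') = 1.
  by move=> Is'; apply: polar_inj (pth' _ Is') (pth _ Is').
have s0 s' : I s' -> sin (th' s' - th s') = 0.
  by move=> Is'; apply/eqP; rewrite -sqrf_eq0 sin2cos2 c// expr1n subrr.
by rewrite !c ?s0 ?mulr1 ?mulr0 ?addr0//; exact: I0.
Qed.

Lemma eq_winding f g f' g' : (forall s, I s -> f s = f' s) ->
  (forall s, I s -> g s = g' s) -> winding f g = winding f' g'.
Proof.
move=> ff gg; rewrite /winding.
suff -> : [set th | angle_lift f g th] = [set th | angle_lift f' g' th] by [].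
by apply/seteqP; split => th [cth pth]; split => // s Is;
  [rewrite -ff// -gg//|rewrite ff// gg//]; exact: pth.
Qed.

(** Lift the angle over the whole square. On the sides s = 0 and s = 1 the point is fixed, so the
    lift is constant there and the variations along bottom and top agree. *)
Lemma winding_homotopy (H1 H2 : R * R -> R) :
  {within II, continuous H1} -> {within II, continuous H2} ->
  (forall p, II p -> 0 < H1 p ^+ 2 + H2 p ^+ 2) ->
  (forall t, I t -> H1 (0, t) = H1 (0, 0) /\ H2 (0, t) = H2 (0, 0)) ->
  (forall t, I t -> H1 (1, t) = H1 (1, 0) /\ H2 (1, t) = H2 (1, 0)) ->
  winding (fun s => H1 (s, 0)) (fun s => H2 (s, 0)) =
  winding (fun s => H1 (s, 1)) (fun s => H2 (s, 1)).
Proof.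
move=> c1 c2 H0 e0 e1.
have [th [cth pth]] := polar_lift_homotopy c1 c2 H0.
have L t : I t -> angle_lift (fun s => H1 (s, t)) (fun s => H2 (s, t)) (fun s => th (s, t)).
  move=> It; split; last by move=> s Is; apply: (pth (s, t)).
  apply: (@within_comp _ _ _ I II (fun s => (s, t)) th) => //.
  apply: continuous_subspaceT => s.
  by apply: (@cvg_pair _ _ _ _ (nbhs _) (nbhs _)); [exact: cvg_id|exact: cvg_cst].
have side a : I a -> (forall t, I t -> H1 (a, t) = H1 (a, 0) /\ H2 (a, t) = H2 (a, 0)) ->
    th (a, 1) = th (a, 0).
  move=> Ia ea; apply: (@cos_eq1_const (fun t => th (a, t))) I1.
    apply: (@within_comp _ _ _ I II (fun t => (a, t)) th) => //.
    apply: continuous_subspaceT => s.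
    by apply: (@cvg_pair _ _ _ _ (nbhs _) (nbhs _)); [exact: cvg_cst|exact: cvg_id].
  move=> t It; apply: (@polar_inj _ _ (H1 (a, 0)) (H2 (a, 0))).
    by have [<- <-] := ea t It; apply: (pth (a, t)).
  by apply: (pth (a, 0)); split => //; exact: I0.
rewrite (windingE (L _ I0)) (windingE (L _ I1)).
by rewrite (side _ I0 e0) (side _ I1 e1).
Qed.

Lemma winding_cat f g f' g' : plane_path f g -> plane_path f' g' ->
  f 1 = f' 0 -> g 1 = g' 0 ->
  winding (path_cat f f') (path_cat g g') = winding f g + winding f' g'.
Proof.
move=> p p' ef eg.
have [th [cth pth]] := angle_lift_exists p.
have [th' [cth' pth']] := angle_lift_exists p'.
(* The two lifts may differ at the junction by a multiple of 2 pi; shifting the second one by [d]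
   lets them be glued. *)
pose d := th 1 - th' 0.
have cd : cos d = 1.
  apply: (@polar_inj _ _ (f 1) (g 1)); first exact: pth I1.
  by rewrite ef eg; exact: pth' I0.
have P1 : is_path setT (th 0) (th 1) th by split.
have P2 : is_path setT (th 1) (th' 1 + d) (fun s => th' s + d).
  split => //; last by rewrite /d; ring.
  by move=> x; apply: cvgD; [exact: cth'|exact: cvg_cst].
have [cP _ c0 c1] := is_path_cat P1 P2.
rewrite (windingE (conj cth pth)) (windingE (conj cth' pth')).
rewrite (@windingE _ _ (path_cat th (fun s => th' s + d))); last first.
  split => // s /IE Is; rewrite /path_cat; case: ifPn => [?|].
    by apply: pth; apply/IE; lra.
  by rewrite -ltNge => ?; apply: polar_shift => //; apply: pth'; apply/IE; lra.
by rewrite c0 c1 /d; ring.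
Qed.

Lemma winding_rev f g : plane_path f g ->
  winding (path_rev f) (path_rev g) = - winding f g.
Proof.
move=> p; have [th [cth pth]] := angle_lift_exists p.
have P1 : is_path setT (th 0) (th 1) th by split.
have [cP _ c0 c1] := is_path_rev P1.
rewrite (windingE (conj cth pth)) (@windingE _ _ (path_rev th)).
  by rewrite c0 c1; ring.
by split => // s /IE Is; apply: pth; apply/IE; lra.
Qed.

Lemma winding_oppl f g : plane_path f g ->
  winding (fun s => - f s) g = - winding f g.
Proof.
move=> p; have [th [cth pth]] := angle_lift_exists p.
rewrite (windingE (conj cth pth)) (@windingE _ _ (fun s => pi - th s)); first by ring.
split=> [x|s Is]; first by apply: cvgB; [exact: cvg_cst|exact: cth].
have [r r0 [-> ->]] := pth _ Is; exists r => //.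
by rewrite cosB sinB cospi sinpi; split; ring.
Qed.

Lemma winding_oppr f g : plane_path f g ->
  winding f (fun s => - g s) = - winding f g.
Proof.
move=> p; have [th [cth pth]] := angle_lift_exists p.
rewrite (windingE (conj cth pth)) (@windingE _ _ (fun s => - th s)); first by ring.
split=> [x|s Is]; first by apply: cvgN; exact: cth.
have [r r0 [-> ->]] := pth _ Is; exists r => //.
by rewrite cosN sinN; split; ring.
Qed.

(* The polar angle in the closed first quadrant; measuring it from the        *)
(* diagonal keeps the argument of atan finite on both axes.                   *)
Definition quadrant_angle u v := pi / 4%:R + atan ((v - u) / (u + v)).

Lemma quadrant_angle_gt0 u v : 0 < u -> 0 < v -> 0 < quadrant_angle u v < pi / 2.
Proof.
move=> u0 v0; rewrite /quadrant_angle.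
have uv : 0 < u + v by rewrite addr_gt0.
have lt1 : (v - u) / (u + v) < 1 by rewrite ltr_pdivrMr//; lra.
have gt1 : -1 < (v - u) / (u + v) by rewrite ltr_pdivlMr//; lra.
have := lt_atan lt1; have := lt_atan gt1; rewrite atanN atan1 => ? ?; lra.
Qed.

Lemma quadrant_angle_l v : 0 < v -> quadrant_angle 0 v = pi / 2.
Proof.
by move=> v0; rewrite /quadrant_angle subr0 add0r divff ?gt_eqF// atan1; lra.
Qed.

Lemma quadrant_angle_r u : 0 < u -> quadrant_angle u 0 = 0.
Proof.
move=> u0; rewrite /quadrant_angle sub0r addr0 mulNr divff ?gt_eqF// atanN atan1; lra.
Qed.

(** The quadrant angle is itself a continuous lift: it is pi / 4, the angle of (1, 1), plus the
    small angle measured from there. *)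
Lemma winding_quadrant f g : plane_path f g ->
  (forall s, I s -> 0 <= f s) -> (forall s, I s -> 0 <= g s) ->
  winding f g = quadrant_angle (f 1) (g 1) - quadrant_angle (f 0) (g 0).
Proof.
move=> [cf cg p0] f0 g0; rewrite (@windingE _ _ (fun s => quadrant_angle (f s) (g s)))//.
have fg0 s : I s -> 0 < f s + g s.
  move=> Is; rewrite lt_neqAle addr_ge0 ?f0 ?g0// andbT eq_sym.
  apply/eqP => e; have := p0 s Is; have := f0 s Is; have := g0 s Is => ? ? ?.
  have fz : f s = 0 by lra.
  have gz : g s = 0 by lra.
  by move: (p0 s Is); rewrite fz gz expr0n addr0 ltxx.
have aE s : quadrant_angle (f s) (g s) = pi / 4%:R + small_angle 1 1 (f s) (g s).
  by rewrite /small_angle !mul1r.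
split=> [|s Is]; last first.
  rewrite aE; apply: polar_small_angle; last by rewrite !mul1r fg0.
  have h : (1 : R) = Num.sqrt (1 + 1 ^+ 2) * cos (pi / 4%:R).
    by rewrite -atan1 cos_atan divff// gt_eqF// sqrtr_gt0 ltr_pwDl// sqr_ge0.
  exists (Num.sqrt (1 + 1 ^+ 2)); first by rewrite sqrtr_gt0 ltr_pwDl// sqr_ge0.
  split=> //; rewrite {1}h; congr (_ * _).
  have c0 : cos (pi / 4%:R) != 0 :> R.
    by apply/eqP => e; move: h; rewrite e mulr0 => /eqP; rewrite oner_eq0.
  apply: (mulfI (invr_neq0 c0)); rewrite mulVf//.
  by rewrite mulrC -[LHS](atanK 1) atan1.
apply: (@within_eq _ _ _ (fun s => pi / 4%:R + small_angle 1 1 (f s) (g s))).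
  by move=> s _; rewrite aE.
apply/subspace_continuousP => s Is; apply: cvgD; first exact: cvg_cst.
apply: (@cvg_comp _ _ _ (fun s => (1 * g s - 1 * f s) / (1 * f s + 1 * g s)) atan
  _ _ _ _ (@continuous_atan _ _)).
have cf' : f x @[x --> within I (nbhs s)] --> f s by move/subspace_continuousP: cf; exact.
have cg' : g x @[x --> within I (nbhs s)] --> g s by move/subspace_continuousP: cg; exact.
apply: cvgM; first by apply: cvgB; apply: cvgM => //; exact: cvg_cst.
apply: cvgV; first by rewrite !mul1r gt_eqF// fg0.
by apply: cvgD; apply: cvgM => //; exact: cvg_cst.
Qed.
End Angles.

(** * Paths in Z(P) *)

Section UnitIntervalInduction.
Context {R : realType}.
Local Notation I := (unit_interval : set R).

(** Connectedness as an induction principle. The local step runs in both directions, so both Q and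
    its negation are open conditions. *)
Lemma unit_interval_induction (Q : R -> Prop) : Q 0 ->
  (forall s0, I s0 -> exists2 d, 0 < d & forall s s', I s -> I s' ->
     `|s0 - s| < d -> `|s0 - s'| < d -> Q s -> Q s') ->
  Q 1.
Proof.
move=> Q0 step.
pose U (T : R -> Prop) : set R := [set r | exists s0 d, [/\ I s0, 0 < d, T s0,
  forall s s', I s -> I s' -> `|s0 - s| < d -> `|s0 - s'| < d -> Q s -> Q s' &
  `|s0 - r| < d]].
have oU T : open (U T).
  rewrite openE => r [s0 [d [Is0 d0 Ts0 st r0]]].
  apply/nbhs_ballP; exists (d - `|s0 - r|); first by rewrite /= subr_gt0.
  move=> r' /=; rewrite /ball/= => rr'; exists s0, d; split => //.
  rewrite (_ : s0 - r' = (s0 - r) + (r - r')); last by ring.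
  by apply: (le_lt_trans (ler_normD _ _)); lra.
have inU T s : I s -> T s -> U T s.
  by move=> Is Ts; have [d d0 st] := step s Is; exists s, d; split=> //; rewrite subrr normr0.
have : I `&` [set s | Q s] = I.
  apply: segment_connected.
  - by exists 0; split=> //; exact: I0.
  - exists (U Q); first exact: oU.
    apply/seteqP; split=> s [Is Qs]; first by split=> //; exact: inU.
    split=> //; case: Qs => s0 [d [Is0 d0 Qs0 st r0]].
    by apply: (st s0) => //; rewrite subrr normr0.
  - exists (~` U (fun s => ~ Q s)); first by apply: open_closedC; exact: oU.
    apply/seteqP; split=> s [Is Qs]; split=> //.
      move=> [s0 [d [Is0 d0 nQ st r0]]]; apply: nQ.
      by apply: (st s) => //; rewrite subrr normr0.
    by apply: contrapT => nQ; apply: Qs; exact: inU.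
by move=> /seteqP[_ /(_ 1 I1)[]].
Qed.
End UnitIntervalInduction.

Section SubPaths.
Context {R : realType} {T : topologicalType}.
Implicit Types (S : set T) (f : R -> T) (a b c : R).
Local Notation I := (unit_interval : set R).

(** The case b < a is allowed and runs f backwards, as the induction on the interval requires. *)
Definition subpath f a b : R -> T := fun u => f (a + u * (b - a)).

Lemma is_path_subpath S x y f a b : is_path S x y f -> I a -> I b ->
  is_path S (f a) (f b) (subpath f a b).
Proof.
move=> [cf Sf _ _] /IE Ia /IE Ib.
have Iu u : I u -> I (a + u * (b - a)) by move=> /IE ?; apply/IE; nra.
split.
- apply: (@within_comp _ _ _ _ I (fun u : R => a + u * (b - a)) f) => //.
  apply: continuous_subspaceT => u; apply: cvgD; first exact: cvg_cst.
  by apply: cvgM; [exact: cvg_id|exact: cvg_cst].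
- by move=> u /Iu; exact: Sf.
- by rewrite /subpath mul0r addr0.
- by rewrite /subpath mul1r addrC subrK.
Qed.

Lemma subpath01 f : subpath f 0 1 = f.
Proof. by apply/funext => u; rewrite /subpath subr0 mulr1 add0r. Qed.

Lemma homotopic_subpath_cat S x y f a b c : is_path S x y f -> I a -> I b -> I c ->
  homotopic S (path_cat (subpath f a b) (subpath f b c)) (subpath f a c).
Proof.
move=> pf /IE Ia /IE Ib /IE Ic.
pose phi (u : R) : R := a + Num.min (2 * u) 1 * (b - a) + Num.max (2 * u - 1) 0 * (c - b).
pose psi (u : R) : R := a + u * (c - a).
have phiE u : phi u = if 2 * u <= 1 then a + 2 * u * (b - a) else b + (2 * u - 1) * (c - b).
  by rewrite /phi minEle maxEle; case: leP => ?; case: leP => ?; try lra; ring.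
apply: (homotopic_eq (f := f \o phi) (g := f \o psi)) => //.
  by move=> u _ /=; rewrite phiE /path_cat /subpath; case: ifP.
have c2 : continuous (fun u : R => 2 * u).
  by move=> u; apply: cvgM; [exact: cvg_cst|exact: cvg_id].
apply: (homotopic_reparam pf).
- move=> u; apply: cvgD; [apply: cvgD; first exact: cvg_cst|].
    apply: cvgM; last exact: cvg_cst.
    by apply: (@continuous_min R R _ (fun=> 1)); [exact: c2|exact: cvg_cst].
  apply: cvgM; last exact: cvg_cst.
  apply: (@continuous_max R R (fun u => 2 * u - 1) (fun=> 0)); last exact: cvg_cst.
  by apply: cvgB; [exact: c2|exact: cvg_cst].
- move=> u; apply: cvgD; first exact: cvg_cst.
  by apply: cvgM; [exact: cvg_id|exact: cvg_cst].
- by move=> u /IE ?; apply/IE; rewrite phiE; case: ifPn; rewrite -?ltNge => ?; nra.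
- by move=> u /IE ?; apply/IE; rewrite /psi; nra.
- by rewrite phiE /psi mulr0 ler01 !mul0r.
- by rewrite phiE /psi mulr1 two_le1 two_sub1 !mul1r; ring.
Qed.
End SubPaths.

(** * Coordinates in which the chambers of Z(P) are convex *)

Section SignedSquare.
Context {R : realType}.
Implicit Types x y : R.

Definition ssq x : R := x * `|x|.
(** [Num.sqrt] is 0 on negative numbers, so at most one term survives and this inverts [ssq] on the
    whole line. *)
Definition ssqrt y : R := Num.sqrt y - Num.sqrt (- y).

Lemma ssqK : cancel ssq ssqrt.
Proof.
move=> x; rewrite /ssqrt /ssq; have [x0|x0] := ger0P x.
  rewrite -expr2 sqrtr_sqr ger0_norm// (@ler0_sqrtr _ (- _)) ?subr0//.
  by rewrite oppr_le0 sqr_ge0.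
rewrite mulrN opprK -expr2 sqrtr_sqr ltr0_norm// ler0_sqrtr ?sub0r ?opprK//.
by rewrite oppr_le0 sqr_ge0.
Qed.

Lemma ssqrtN y : ssqrt (- y) = - ssqrt y.
Proof. by rewrite /ssqrt opprK opprB. Qed.

Lemma ssqN x : ssq (- x) = - ssq x.
Proof. by rewrite /ssq normrN mulNr. Qed.

Lemma ssqrt_ge0 y : 0 <= y -> 0 <= ssqrt y.
Proof. by move=> y0; rewrite /ssqrt (@ler0_sqrtr _ (- _)) ?oppr_le0// subr0 sqrtr_ge0. Qed.

Lemma ssq_ge0 x : 0 <= x -> 0 <= ssq x.
Proof. by move=> x0; rewrite mulr_ge0. Qed.

Lemma sqr_ssqrt y : 0 <= y -> ssqrt y ^+ 2 = y.
Proof.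
by move=> y0; rewrite /ssqrt (@ler0_sqrtr _ (- _)) ?oppr_le0// subr0 sqr_sqrtr.
Qed.

Lemma ssq_continuous : continuous ssq.
Proof.
move=> x; apply: cvgM; first exact: cvg_id.
exact: norm_continuous.
Qed.

Lemma ssqrt_continuous : continuous ssqrt.
Proof.
move=> y; apply: cvgB; first exact: sqrt_continuous.
apply: (@continuous_comp _ _ _ -%R Num.sqrt); first exact: opp_continuous.
exact: sqrt_continuous.
Qed.
End SignedSquare.

Section Segments.
Context {R : realType} {n : nat}.
Implicit Types (a b x y p : 'rV[R]_n) (g h : 'rV['Z_2]_n) (t : R).
Local Notation I := (unit_interval : set R).
Local Notation II := (unit_interval `*` unit_interval : set (R * R)).

Lemma cvg_rowP (T : Type) (F : set_system T) (FF : Filter F) (f : T -> 'rV[R]_n) x :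
  (forall i, (fun s => f s 0 i) @ F --> x 0 i) -> f @ F --> x.
Proof.
move=> fx W [B Bx BW].
have : \forall s \near F, forall i, B 0 i (f s 0 i).
  by apply: filter_forall => i; apply: (fx i); have := Bx 0 i.
by apply: filterS => s fs; apply: BW => i j; rewrite ord1.
Qed.

Lemma within_row (T : topologicalType) (A : set T) (f : T -> 'rV[R]_n) :
  (forall i, {within A, continuous (fun s => f s 0 i)}) -> {within A, continuous f}.
Proof.
move=> cf; apply/subspace_continuousP => s As; apply: cvg_rowP => i.
by have /subspace_continuousP := cf i; exact.
Qed.

Lemma within_coord (T : topologicalType) (A : set T) (f : T -> 'rV[R]_n) i :
  {within A, continuous f} -> {within A, continuous (fun s => f s 0 i)}.
Proof.
move=> cf; apply: (@within_comp _ _ _ A setT f (fun x : 'rV[R]_n => x 0 i)) => //.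
apply: continuous_subspaceT; exact: coord_continuous.
Qed.

(* The path from a to b whose image under x_i |-> x_i |x_i| is a segment; the *)
(* homeomorphism x_i |-> x_i |x_i| makes Z(P) the union of the mirror images  *)
(* of P.                                                                      *)
Definition seg a b t : 'rV[R]_n :=
  \row_i ssqrt ((1 - t) * ssq (a 0 i) + t * ssq (b 0 i)).

Lemma seg0 a b : seg a b 0 = a.
Proof. by apply/rowP => i; rewrite mxE subr0 mul1r mul0r addr0 ssqK. Qed.

Lemma seg1 a b : seg a b 1 = b.
Proof. by apply/rowP => i; rewrite mxE subrr mul1r mul0r add0r ssqK. Qed.

Lemma segxx a t : seg a a t = a.
Proof. by apply/rowP => i; rewrite mxE -mulrDl subrK mul1r ssqK. Qed.

Lemma segC a b t : seg a b (1 - t) = seg b a t.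
Proof. by apply/rowP => i; rewrite !mxE subKr addrC. Qed.

Lemma path_rev_seg a b : path_rev (seg a b) = seg b a.
Proof. by apply/funext => s; rewrite /path_rev segC. Qed.

Lemma seg_within (T : topologicalType) (A : set T) (f h : T -> 'rV[R]_n) (c : T -> R) :
  {within A, continuous f} -> {within A, continuous h} -> {within A, continuous c} ->
  {within A, continuous (fun s => seg (f s) (h s) (c s))}.
Proof.
move=> cf ch cc; apply: within_row => i.
apply: (@within_eq _ _ _ (fun s => ssqrt ((1 - c s) * ssq (f s 0 i) + c s * ssq (h s 0 i)))).
  by move=> s _; rewrite mxE.
have cs (k : T -> 'rV[R]_n) : {within A, continuous k} ->
    {within A, continuous (fun s => ssq (k s 0 i))}.
  move=> ck; apply: (@within_comp _ _ _ A setT (fun s => k s 0 i) ssq) => //.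
    exact: within_coord.
  apply: continuous_subspaceT; exact: ssq_continuous.
apply: (@within_comp _ _ _ A setT (fun s => (1 - c s) * ssq (f s 0 i) + c s * ssq (h s 0 i)) ssqrt) => //.
  move=> s; apply: cvgD; apply: cvgM; try exact: cs; last exact: cc.
  by apply: cvgB; [exact: cvg_cst|exact: cc].
apply: continuous_subspaceT; exact: ssqrt_continuous.
Qed.

Lemma sign_changeE g x i : sign_change g x 0 i = if g 0 i == 0 then x 0 i else - x 0 i.
Proof.
rewrite mxE; case: (g 0 i) => [[|[|//]] ?]; first by rewrite expr0 mul1r.
by rewrite expr1 mulN1r.
Qed.

Lemma sign_changeK g : involutive (sign_change (R := R) g).
Proof.
move=> x; apply/rowP => i; rewrite !sign_changeE.
by case: (g 0 i == 0); rewrite ?opprK.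
Qed.

Lemma sign_change_seg g a b t :
  sign_change g (seg a b t) = seg (sign_change g a) (sign_change g b) t.
Proof.
apply/rowP => i; rewrite sign_changeE [in RHS]mxE !sign_changeE mxE.
by case: ifP => // _; rewrite !ssqN !mulrN -opprD ssqrtN.
Qed.

Lemma sign_change_comp_seg g a b :
  sign_change g \o seg a b = seg (sign_change g a) (sign_change g b).
Proof. by apply/funext => t; exact: sign_change_seg. Qed.

Definition cochamber a b := forall i, 0 <= a 0 i * b 0 i.

Definition chamber_at g : set 'rV[R]_n := [set x | orthant (sign_change g x)].

Lemma chamber_cochamber g a b : chamber_at g a -> chamber_at g b -> cochamber a b.
Proof.
move=> ga gb i; have := ga i; have := gb i; rewrite !sign_changeE.
by case: ifP => _ ? ?; [exact: mulr_ge0|rewrite -mulrNN mulr_ge0].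
Qed.

Lemma cochamberP a b : cochamber a b -> exists g, chamber_at g a /\ chamber_at g b.
Proof.
move=> ab; exists (\row_i (if (0 <= a 0 i) && (0 <= b 0 i) then 0 else 1)).
by split=> i; rewrite sign_changeE mxE; have := ab i;
  case: (leP 0 (a 0 i)) => ai; case: (leP 0 (b 0 i)) => bi //= ?; nra.
Qed.

Lemma seg_orthant a b t : orthant a -> orthant b -> I t -> orthant (seg a b t).
Proof.
move=> a0 b0 /IE It i; rewrite mxE; apply: ssqrt_ge0.
by have := ssq_ge0 (a0 i); have := ssq_ge0 (b0 i); nra.
Qed.

Lemma seg_chamber g a b t : chamber_at g a -> chamber_at g b -> I t ->
  chamber_at g (seg a b t).
Proof. by rewrite /chamber_at /= sign_change_seg => *; exact: seg_orthant. Qed.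

Section Convex.
Context (P : set 'rV[R]_n).
Context (convexP : forall x y t, P x -> P y -> I t -> P ((1 - t) *: x + t *: y)).
Local Notation Z := (square_preimage P).

(** On a closed orthant the squares are the coordinates x_i |x_i| up to fixed signs, so squaring
    turns [seg] into a straight segment of P. *)
Lemma seg_preimage a b t : Z a -> Z b -> cochamber a b -> I t -> Z (seg a b t).
Proof.
move=> Za Zb ab It; have := convexP Za Zb It.
rewrite /square_preimage /=; congr P; apply/rowP => i; rewrite !mxE.
have /IE t01 := It.
have [c [ca cb]] := cochamberP ab.
have := ca i; have := cb i; rewrite !sign_changeE; case: ifP => _ bi ai.
  rewrite sqr_ssqrt /ssq ?ger0_norm// -?expr2//.
  by have := sqr_ge0 (a 0 i); have := sqr_ge0 (b 0 i); nra.
rewrite -[RHS]sqrrN -ssqrtN opprD -(mulrN (1 - t)) -(mulrN t) -!ssqN sqr_ssqrt /ssq ?ger0_norm// -?expr2 ?sqrrN//.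
by have := sqr_ge0 (a 0 i); have := sqr_ge0 (b 0 i); nra.
Qed.

Lemma is_path_seg a b : Z a -> Z b -> cochamber a b -> is_path Z a b (seg a b).
Proof.
move=> Za Zb ab; split.
- apply: (@seg_within R I (fun=> a) (fun=> b) id); try by move=> x; exact: cvg_cst.
  by apply: continuous_subspaceT => x; exact: cvg_id.
- by move=> t; exact: seg_preimage.
- exact: seg0.
- exact: seg1.
Qed.

Lemma homotopic_cochamber x y (f h : R -> 'rV[R]_n) :
  is_path Z x y f -> is_path Z x y h ->
  (forall s, I s -> cochamber (f s) (h s)) -> homotopic Z f h.
Proof.
move=> [cf Zf f0 f1] [ch Zh h0 h1] fh.
have cF (k : R -> 'rV[R]_n) : {within I, continuous k} -> {within II, continuous (k \o fst)}.
  move=> ck; apply: (@within_comp _ _ _ II I fst k) => //; last by move=> p [].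
  by apply: continuous_subspaceT => p; exact: cvg_fst.
exists (fun q => seg (f q.1) (h q.1) q.2); split.
- apply: seg_within; [exact: cF|exact: cF|].
  by apply: continuous_subspaceT => q; exact: cvg_snd.
- by move=> [s t] [/= Is It]; apply: seg_preimage; auto.
- by move=> s _ /=; rewrite seg0 seg1.
- by move=> t _ /=; rewrite f0 f1 h0 h1 !segxx.
Qed.

Lemma homotopic_chamber g x y (f h : R -> 'rV[R]_n) :
  is_path Z x y f -> is_path Z x y h ->
  (forall s, I s -> chamber_at g (f s)) -> (forall s, I s -> chamber_at g (h s)) ->
  homotopic Z f h.
Proof.
move=> pf ph fg hg; apply: homotopic_cochamber pf ph _ => s Is.
by apply: (@chamber_cochamber g); auto.
Qed.

Lemma homotopic_seg_cat g a b c : Z a -> Z b -> Z c ->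
  chamber_at g a -> chamber_at g b -> chamber_at g c ->
  homotopic Z (path_cat (seg a b) (seg b c)) (seg a c).
Proof.
move=> Za Zb Zc ga gb gc.
apply: (@homotopic_chamber g a c).
- by apply: (@is_path_cat _ _ _ _ b); apply: is_path_seg => //; exact: (@chamber_cochamber g).
- by apply: is_path_seg => //; exact: (@chamber_cochamber g).
- move=> s /IE Is; rewrite /path_cat; case: ifPn => [?|].
    by apply: seg_chamber => //; apply/IE; lra.
  by rewrite -ltNge => ?; apply: seg_chamber => //; apply/IE; lra.
- by move=> s Is; apply: seg_chamber.
Qed.

(* Pausing f at its endpoints leaves the time to walk from x to p and from p *)
(* to y while f itself is contracted to p.                                    *)
Lemma homotopic_star x y p (f : R -> 'rV[R]_n) : is_path Z x y f -> Z p ->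
  (forall s, I s -> cochamber (f s) p) ->
  homotopic Z f (path_cat (seg x p) (seg p y)).
Proof.
move=> pf Zp fp; have [_ Zf f0 f1] := pf.
have Zx : Z x by rewrite -f0; apply: Zf; exact: I0.
have Zy : Z y by rewrite -f1; apply: Zf; exact: I1.
have xp : cochamber x p by rewrite -f0; apply: fp; exact: I0.
have yp : cochamber y p by rewrite -f1; apply: fp; exact: I1.
have py : cochamber p y by move=> i; rewrite mulrC.
have py' := is_path_seg Zp Zy py; have px' := is_path_seg Zx Zp xp.
pose F := path_cat (cst x) (path_cat f (cst y)).
have pc := is_path_cat pf (is_path_cst Zy).
have pF : is_path Z x y F by exact: is_path_cat (is_path_cst Zx) pc.
have hF : homotopic Z f F.
  apply: homotopic_sym; apply: homotopic_trans (homotopic_cst_cat pc) _.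
  exact: homotopic_cat_cst pf.
have Fp s : I s -> cochamber (F s) p.
  move=> /IE Is; rewrite /F /path_cat; case: ifPn => // h1; case: ifPn => // h2.
  by move: h1; rewrite -ltNge => h1; apply: fp; apply/IE; lra.
(* F rests at x on [0, 1/2], follows f on [1/2, 3/4] and rests at y on [3/4, 1]. The contraction
   parameter rises from 0 to 1 in the first rest, stays 1 along f, and falls to 0 in the last
   rest. *)
pose tau (s : R) := Num.min 1 (Num.min (2 * s) (4 * (1 - s))).
have tauE s : tau s = if 2 * s <= 1 then 2 * s else if 4 * s <= 3 then 1 else 4 * (1 - s).
  rewrite /tau !minEle.
  by case: (leP (2 * s) (4 * (1 - s))) => ?; do ![case: leP => ?]; lra.
have ctau : continuous tau.
  move=> s; apply: (@continuous_min R R (fun=> 1) (fun s => Num.min (2 * s) (4 * (1 - s)))).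
    exact: cvg_cst.
  apply: (@continuous_min R R (fun s => 2 * s) (fun s => 4 * (1 - s))).
    by apply: cvgM; [exact: cvg_cst|exact: cvg_id].
  by apply: cvgM; [exact: cvg_cst|apply: cvgB; [exact: cvg_cst|exact: cvg_id]].
have Itau s : I s -> I (tau s).
  by move=> /IE ?; apply/IE; rewrite tauE; do 2?[case: ifPn; rewrite -?ltNge => ?]; lra.
apply: homotopic_trans hF _.
apply: (@homotopic_trans _ _ _ _ (path_cat (seg x p) (path_cat (cst p) (seg p y)))); last first.
  apply: (homotopic_cat px' px' _ py'); last exact: homotopic_cst_cat py'.
  - exact: is_path_cat (is_path_cst Zp) py'.
  - exact: homotopic_refl px'.
have [cF ZF F0 F1] := pF.
apply: (homotopic_eq (f := F) (g := fun s => seg (F s) p (tau s))) => //.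
  move=> s _; rewrite tauE {1}/F /path_cat.
  have [h1|h1] := leP (2 * s) 1; first by [].
  have [h2|h2] := leP (4 * s) 3.
    rewrite (_ : 2 * (2 * s - 1) <= 1) ?seg1//; lra.
  rewrite (_ : 2 * (2 * s - 1) <= 1 = false); last by apply/negbTE; lra.
  by rewrite -segC /=; congr seg; lra.
exists (fun q => seg (F q.1) p (q.2 * tau q.1)); split.
- apply: seg_within.
  + apply: (@within_comp _ _ _ II I fst F) => //; last by move=> q [].
    by apply: continuous_subspaceT => q; exact: cvg_fst.
  + by move=> q; exact: cvg_cst.
  + apply: continuous_subspaceT => q; apply: cvgM; first exact: cvg_snd.
    by apply: (@continuous_comp _ _ _ fst tau); [exact: cvg_fst|exact: ctau].
- move=> [s t] [/= Is /IE It]; apply: seg_preimage; auto.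
  by have /IE ? := Itau _ Is; apply/IE; nra.
- by move=> s Is /=; rewrite mul0r mul1r seg0.
- move=> t _ /=; rewrite !tauE mulr0 ler01 mulr0 seg0.
  rewrite (_ : 2 * 1 <= 1 = false); last by apply/negbTE; lra.
  rewrite (_ : 4 * 1 <= 3 = false); last by apply/negbTE; lra.
  by rewrite subrr !mulr0 seg0.
Qed.

(** Coordinates that are nonzero at s0 keep their sign nearby, and zero coordinates impose no
    condition. *)
Lemma cochamber_near x y (f : R -> 'rV[R]_n) s0 : is_path Z x y f -> I s0 ->
  exists2 d, 0 < d & forall s, I s -> `|s0 - s| < d -> cochamber (f s) (f s0).
Proof.
move=> [cf _ _ _] Is0.
have : \forall s \near within I (nbhs s0), forall i, 0 <= f s 0 i * f s0 0 i.
  apply: filter_forall => i.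
  have ci : (fun s => f s 0 i * f s0 0 i) @ within I (nbhs s0) --> f s0 0 i * f s0 0 i.
    have /subspace_continuousP := @within_coord _ I f i cf.
    by move=> /(_ _ Is0) ci; apply: cvgM => //; exact: cvg_cst.
  have [e|ne] := eqVneq (f s0 0 i) 0.
    by apply: nearW => s; rewrite e mulr0.
  have p0 : 0 < f s0 0 i * f s0 0 i by rewrite -expr2 exprn_even_gt0.
  by apply: filterS (cvgr_gt _ ci _ p0) => s /ltW.
rewrite /within /= => /nbhs_ballP[d d0 dH]; exists d => // s Is ss.
by move=> i; apply: dH.
Qed.

End Convex.
End Segments.

(** * Cancellation and conjugation of paths up to homotopy *)

Section HomotopyAlgebra.
Context {R : realType} {T : topologicalType}.
Implicit Types (S : set T) (f g h : R -> T).

Lemma homotopic_catl S x y w f g g' : is_path S x y f -> is_path S y w g ->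
  is_path S y w g' -> homotopic S g g' -> homotopic S (path_cat f g) (path_cat f g').
Proof. by move=> pf pg pg'; apply: (homotopic_cat pf pf pg pg' _); exact: homotopic_refl pf. Qed.

Lemma homotopic_catr S x y w f f' g : is_path S x y f -> is_path S x y f' ->
  is_path S y w g -> homotopic S f f' -> homotopic S (path_cat f g) (path_cat f' g).
Proof.
move=> pf pf' pg ff'; apply: (homotopic_cat pf pf' pg pg ff' _); exact: homotopic_refl pg.
Qed.

Lemma homotopic_cat_cancel S x y w v f g h :
  is_path S x y f -> is_path S y w g -> is_path S y v h ->
  homotopic S (path_cat (path_cat f g) (path_cat (path_rev g) h)) (path_cat f h).
Proof.
move=> pf pg ph; have pr := is_path_rev pg; have prh := is_path_cat pr ph.
apply: (homotopic_trans (homotopic_sym (homotopic_catA pf pg prh)) _).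
apply: (homotopic_catl pf (is_path_cat pg prh) ph _).
apply: (homotopic_trans (homotopic_catA pg pr ph) _).
have [_ Sg g0 _] := pg; have Sy : S y by rewrite -g0; apply: Sg; exact: I0.
apply: (homotopic_trans _ (homotopic_cst_cat ph)).
apply: (homotopic_catr (is_path_cat pg pr) (is_path_cst Sy) ph _).
exact: homotopic_cat_rev pg.
Qed.

Lemma homotopic_conj S x y f d : is_path S y y f -> is_path S x y d ->
  homotopic S f
    (path_cat (path_rev d) (path_cat (path_cat (path_cat d f) (path_rev d)) d)).
Proof.
move=> pf pd; have pr := is_path_rev pd.
have pdf := is_path_cat pd pf; have pdfr := is_path_cat pdf pr.
have [_ Sf f0 _] := pf; have Sy : S y by rewrite -f0; apply: Sf; exact: I0.
have h1 : homotopic S (path_cat (path_cat (path_cat d f) (path_rev d)) d) (path_cat d f).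
  apply: (homotopic_trans (homotopic_sym (homotopic_catA pdf pr pd)) _).
  apply: (homotopic_trans _ (homotopic_cat_cst pdf)).
  apply: (homotopic_catl pdf (is_path_cat pr pd) (is_path_cst Sy) _).
  exact: homotopic_rev_cat pd.
apply: homotopic_sym.
apply: (homotopic_trans (homotopic_catl pr (is_path_cat pdfr pd) pdf h1) _).
apply: (homotopic_trans (homotopic_catA pr pd pf) _).
apply: (homotopic_trans _ (homotopic_cst_cat pf)).
apply: (homotopic_catr (is_path_cat pr pd) (is_path_cst Sy) pf _).
exact: homotopic_rev_cat pd.
Qed.

Lemma homotopic_conj_inj S x y f g d :
  is_path S y y f -> is_path S y y g -> is_path S x y d ->
  homotopic S (path_cat (path_cat d f) (path_rev d))
              (path_cat (path_cat d g) (path_rev d)) ->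
  homotopic S f g.
Proof.
move=> pf pg pd fg; have pr := is_path_rev pd.
have pdf := is_path_cat (is_path_cat pd pf) pr.
have pdg := is_path_cat (is_path_cat pd pg) pr.
apply: (homotopic_trans (homotopic_conj pf pd) _).
apply: (homotopic_trans _ (homotopic_sym (homotopic_conj pg pd))).
apply: (homotopic_catl pr (is_path_cat pdf pd) (is_path_cat pdg pd) _).
exact: homotopic_catr pdf pdg pd fg.
Qed.

End HomotopyAlgebra.

(** * Generation of the orbifold group *)

Section Words.
Context {I : Type} {G : groupType} (x : I -> G).
Local Open Scope group_scope.

Lemma eval_word_cat u v : eval_word x (u ++ v) = eval_word x u * eval_word x v.
Proof. by rewrite /eval_word big_cat. Qed.

Lemma eval_word_cons l u :
  eval_word x (l :: u) = (if l.2 then (x l.1)^-1 else x l.1) * eval_word x u.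
Proof. by rewrite /eval_word big_cons. Qed.

Lemma eval_word_nil : eval_word x [::] = 1.
Proof. by rewrite /eval_word big_nil. Qed.

Lemma presented_eq_eval (rels : set (word I)) :
  (forall r, rels r -> eval_word x r = 1) ->
  forall u v, presented_eq rels u v -> eval_word x u = eval_word x v.
Proof.
move=> rels1 u v; elim=> {u v} //.
- by move=> u v w _ -> _ ->.
- by move=> u u' v v' _ eu _ ev; rewrite !eval_word_cat eu ev.
- by move=> i [|]; rewrite !eval_word_cons eval_word_nil mulg1 /= ?mulVg ?mulgV.
- by move=> r /rels1 ->; rewrite eval_word_nil.
Qed.

Lemma eval_word_sq i : eval_word x (word_sq i) = x i * x i.
Proof. by rewrite !eval_word_cons eval_word_nil mulg1. Qed.

Lemma eval_word_comm1 i j : x i * x j = x j * x i -> eval_word x (word_comm i j) = 1.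
Proof.
move=> c; rewrite !eval_word_cons eval_word_nil mulg1 /=.
by rewrite c mulKg mulVg.
Qed.
End Words.

Section OrbifoldGeneration.
Context {R : realType} {n : nat} {P : set 'rV[R]_n}.
Context (convexP : forall (x y : 'rV[R]_n) (t : R), P x -> P y ->
  (unit_interval : set R) t -> P ((1 - t) *: x + t *: y)).
Context (z : square_preimage P) (z_gt0 : forall i, 0 < set_val z 0 i).
Implicit Types (p q x y : 'rV[R]_n) (g h : 'rV['Z_2]_n) (f k : orbi_path z).
Local Notation Z := (square_preimage P).
Local Notation z0 := (set_val z).
Local Notation I := (unit_interval : set R).

Lemma Z2_addrr g : g + g = 0.
Proof. by apply/rowP => i; rewrite !mxE; apply: val_inj; case: (g 0 i) => [[|[|]]]. Qed.

Lemma sign_change_addK g h x : sign_change (g + h) (sign_change g x) = sign_change h x.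
Proof.
by have /(congr1 (@^~ x)) /= <- := sign_changeD (R := R) (g + h) g;
  rewrite addrAC Z2_addrr add0r.
Qed.

Lemma Zz0 : Z z0.
Proof. exact: set_valS. Qed.

Lemma orthant_z0 : orthant z0.
Proof. by move=> i; exact: ltW. Qed.

Lemma Z_sign g x : Z x -> Z (sign_change g x).
Proof. exact: square_preimage_sign. Qed.

Lemma chamber_sign g x : orthant x -> chamber_at g (sign_change g x).
Proof. by rewrite /chamber_at /= sign_changeK. Qed.

Lemma chamber_at0 x : orthant x -> chamber_at 0 x.
Proof. by rewrite /chamber_at /= sign_change0. Qed.

Lemma sign_change_chamber g h x : chamber_at g x -> chamber_at h x ->
  sign_change g x = sign_change h x.
Proof.
move=> gx hx; apply/rowP => i; have := gx i; have := hx i; rewrite !sign_changeE.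
by case: ifP; case: ifP => // _ _ ? ?; lra.
Qed.

Lemma chamber_z0 g h : chamber_at g (sign_change h z0) -> g = h.
Proof.
move=> gh; apply/rowP => i; have := gh i; have := z_gt0 i.
rewrite !sign_changeE.
have Z2E (a b : 'Z_2) : (a == 0) = (b == 0) -> a = b.
  by move: a b => [[|[|//]] ?] [[|[|//]] ?] //= _; exact: val_inj.
case: (boolP (g 0 i == 0)) => g0; case: (boolP (h 0 i == 0)) => h0 zi hi;
  try (by apply: Z2E; rewrite ?(eqP g0) ?(eqP h0) ?(negbTE g0) ?(negbTE h0));
  by clear g0 h0; exfalso; lra.
Qed.

Definition mirror_fun q g : R -> 'rV[R]_n :=
  path_cat (seg z0 q) (seg q (sign_change g z0)).

Lemma is_path_seg_z0 g x : Z x -> chamber_at g x ->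
  is_path Z (sign_change g z0) x (seg (sign_change g z0) x).
Proof.
move=> Zx gx; apply: (is_path_seg convexP) => //; first by apply: Z_sign; exact: Zz0.
apply: (@chamber_cochamber _ _ g) => //; apply: chamber_sign; exact: orthant_z0.
Qed.

Lemma mirror_fun_path q g : Z q -> orthant q -> sign_change g q = q ->
  is_path Z z0 (sign_change g z0) (mirror_fun q g).
Proof.
move=> Zq oq gq; apply: (@is_path_cat _ _ _ _ q).
  have := @is_path_seg_z0 0 q Zq (chamber_at0 oq).
  by rewrite sign_change0.
rewrite -path_rev_seg; apply: is_path_rev; apply: is_path_seg_z0 => //.
by rewrite /chamber_at /= gq.
Qed.

(* The reflection in all facets i with g_i = 1, performed at a point q of     *)
(* their intersection.                                                        *)
Definition mirror q g (Zq : Z q) (oq : orthant q) (gq : sign_change g q = q) :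
  orbifold_group z := orbi_class (OrbiPath (mirror_fun_path Zq oq gq)).

Lemma mirror_eq q g g' Zq oq gq gq' : g = g' ->
  @mirror q g Zq oq gq = @mirror q g' Zq oq gq'.
Proof.
move=> e; apply/orbi_classP; split=> //=; rewrite e.
exact: homotopic_refl (mirror_fun_path Zq oq gq').
Qed.

Lemma orbi_classM f k : (orbi_class f * orbi_class k)%g = orbi_class (orbi_mul f k).
Proof. exact: orbg_mulE. Qed.

(** As g fixes q, the return leg of the first path and the outgoing leg of the translated second one
    are inverse to each other. Mirrors at q thus multiply like the sign changes fixing q. *)
Lemma mirrorM q g h Zq oq gq hq ghq :
  (@mirror q g Zq oq gq * @mirror q h Zq oq hq)%g = @mirror q (g + h) Zq oq ghq.
Proof.
rewrite orbi_classM; apply/orbi_classP; split=> //=.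
rewrite /mirror_fun comp_path_cat !sign_change_comp_seg gq.
rewrite -[sign_change g (sign_change h z0)]/((sign_change g \o sign_change h) z0) -sign_changeD.
have gq' : chamber_at g q by rewrite /chamber_at /= gq.
have ghq' : chamber_at (g + h) q by rewrite /chamber_at /= ghq.
have p1 := is_path_seg_z0 Zq (chamber_at0 oq); rewrite sign_change0 in p1.
have p2 := is_path_rev (is_path_seg_z0 Zq gq'); rewrite path_rev_seg in p2.
have p3 := is_path_rev (is_path_seg_z0 Zq ghq'); rewrite path_rev_seg in p3.
by have := homotopic_cat_cancel p1 p2 p3; rewrite path_rev_seg.
Qed.

Lemma mirror0 q Zq oq gq : @mirror q 0 Zq oq gq = 1%g.
Proof.
apply/orbi_classP; split=> //=; rewrite /mirror_fun sign_change0.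
have p1 := is_path_seg_z0 Zq (chamber_at0 oq); rewrite sign_change0 in p1.
by have := homotopic_cat_rev p1; rewrite path_rev_seg.
Qed.

Lemma sign_change_fix g q : (forall i, g 0 i != 0 -> q 0 i = 0) -> sign_change g q = q.
Proof.
move=> gq; apply/rowP => i; rewrite sign_changeE; case: ifPn => // /gq ->.
by rewrite oppr0.
Qed.

Lemma delta_fix q (i : 'I_n) : q 0 i = 0 -> sign_change (delta_mx 0 i) q = q.
Proof.
by move=> qi; apply: sign_change_fix => j; rewrite mxE eqxx /=; have [->//|_] := eqVneq j i;
  rewrite eqxx.
Qed.

Definition facet_mirror q (i : 'I_n) (Zq : Z q) (oq : orthant q) (qi : q 0 i = 0) :=
  mirror Zq oq (delta_fix qi).

Lemma facet_reflection_mirror q i Zq oq qi : facet_reflection i (@facet_mirror q i Zq oq qi).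
Proof.
exists q, (seg z0 q), (OrbiPath (mirror_fun_path Zq oq (delta_fix qi))).
split=> //; last first.
  by rewrite /= /mirror_fun sign_change_comp_seg path_rev_seg (delta_fix qi).
have p1 := is_path_seg_z0 Zq (chamber_at0 oq); rewrite sign_change0 in p1.
case: p1 => c Zs s0 s1; split=> // s Is; split; first exact: Zs.
by apply: seg_orthant => //; exact: orthant_z0.
Qed.

(* Both paths can be contracted inside the chambers they traverse, which meet *)
(* in a convex copy of the facet.                                             *)
Lemma facet_reflection_uniq q i Zq oq qi c : facet_reflection i c ->
  c = @facet_mirror q i Zq oq qi.
Proof.
move=> [q' [gamma [f [[cg Zg g0 g1] q'i sf ef ->]]]].
set e := delta_mx 0 i in sf ef.
apply/orbi_classP; split=> //=; rewrite ef /mirror_fun -/e.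
have [Zq' oq'] : Z q' /\ orthant q' by rewrite -g1; apply: Zg; exact: I1.
have pg : is_path Z z0 q' gamma by split=> // s /Zg[].
have p1 := is_path_seg_z0 Zq (chamber_at0 oq); rewrite sign_change0 in p1.
have eq : sign_change e q = q by exact: delta_fix.
have eq' : sign_change e q' = q' by exact: delta_fix.
have ceq : chamber_at e q by rewrite /chamber_at /= eq.
have ceq' : chamber_at e q' by rewrite /chamber_at /= eq'.
have p2 : is_path Z q q' (seg q q').
  by apply: (is_path_seg convexP) => //; exact: (@chamber_cochamber _ _ e).
have p3 := is_path_rev (is_path_seg_z0 Zq ceq); rewrite path_rev_seg in p3.
have pg' : is_path Z q' (sign_change e z0) (path_rev (sign_change e \o gamma)).
  by apply: is_path_rev; rewrite -{1}eq'; exact: is_path_sign.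
(* Insert the detour from q to q' and back; the first half then stays in the chamber 0 and the
   second in the chamber e. *)
apply: (homotopic_trans _ (homotopic_cat_cancel p1 p2 p3)).
have pr := is_path_cat (is_path_rev p2) p3.
apply: (homotopic_cat pg (is_path_cat p1 p2) pg' pr _ _).
  apply: (homotopic_chamber convexP (g := 0) pg (is_path_cat p1 p2) _ _).
    by move=> s /Zg[_ ?]; exact: chamber_at0.
  move=> s /IE Is; rewrite /path_cat; case: ifPn => [?|].
    by apply: seg_chamber; [exact: chamber_at0 orthant_z0|exact: chamber_at0|apply/IE; lra].
  by rewrite -ltNge => ?; apply: seg_chamber; [exact: chamber_at0|exact: chamber_at0|apply/IE; lra].
apply: (homotopic_chamber convexP (g := e) pg' pr _ _).
  move=> s /IE Is; rewrite /path_rev /=; apply: chamber_sign.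
  have Is' : I (1 - s) by apply/IE; lra.
  by have [] := Zg _ Is'.
have cez : chamber_at e (sign_change e z0) by apply: chamber_sign; exact: orthant_z0.
move=> s /IE Is; rewrite path_rev_seg /path_cat; case: ifPn => [?|].
  by apply: seg_chamber => //; apply/IE; lra.
by rewrite -ltNge => ?; apply: seg_chamber => //; apply/IE; lra.
Qed.

Section Generators.
Context (x_ : 'I_n -> orbifold_group z).
Context (x_mirror : forall q i Zq oq qi, @facet_mirror q i Zq oq qi = x_ i).

Lemma generator_sq q i : Z q -> orthant q -> q 0 i = 0 -> (x_ i * x_ i)%g = 1%g.
Proof.
move=> Zq oq qi; rewrite -(x_mirror Zq oq qi).
have e : sign_change (delta_mx 0 i + delta_mx 0 i) q = q by rewrite Z2_addrr sign_change0.
rewrite (mirrorM Zq oq _ _ e) -(mirror0 Zq oq (congr1 (@^~ q) (sign_change0 (R := R)))).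
by apply: mirror_eq; exact: Z2_addrr.
Qed.

Lemma generator_comm q i j : Z q -> orthant q -> q 0 i = 0 -> q 0 j = 0 ->
  (x_ i * x_ j)%g = (x_ j * x_ i)%g.
Proof.
move=> Zq oq qi qj; rewrite -(x_mirror Zq oq qi) -(x_mirror Zq oq qj).
have e (a b : 'I_n) : q 0 a = 0 -> q 0 b = 0 ->
    sign_change (delta_mx 0 a + delta_mx 0 b) q = q.
  by move=> qa qb; rewrite sign_changeD /= !delta_fix.
by rewrite (mirrorM Zq oq _ _ (e _ _ qi qj)) (mirrorM Zq oq _ _ (e _ _ qj qi));
  apply: mirror_eq; rewrite addrC.
Qed.

Lemma mirror_word q g Zq oq gq :
  exists w, eval_word x_ w = @mirror q g Zq oq gq.
Proof.
have gen (s : seq 'I_n) : (forall i, i \in s -> q 0 i = 0) ->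
    forall gs, exists w, eval_word x_ w = @mirror q (\sum_(i <- s) delta_mx 0 i) Zq oq gs.
  elim: s => [_ gs|i s IH s0 gs].
    exists [::]; rewrite eval_word_nil -(mirror0 Zq oq (congr1 (@^~ q) (sign_change0 (R := R)))).
    by apply: mirror_eq; rewrite big_nil.
  have qi : q 0 i = 0 by apply: s0; rewrite mem_head.
  have gs' : sign_change (\sum_(i <- s) delta_mx 0 i) q = q.
    move: gs; rewrite big_cons sign_changeD /= => gs.
    by rewrite -[LHS](sign_changeK (delta_mx 0 i)) gs delta_fix.
  have [|w ew] := IH _ gs'; first by move=> j js; apply: s0; rewrite inE js orbT.
  exists ((i, false) :: w); rewrite eval_word_cons ew /= -(x_mirror Zq oq qi).
  have gs2 : sign_change (delta_mx 0 i + \sum_(i <- s) delta_mx 0 i) q = q.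
    by rewrite sign_changeD /= gs' delta_fix.
  by rewrite (mirrorM Zq oq _ _ gs2); apply: mirror_eq; rewrite big_cons.
have gE : g = \sum_(i <- enum [pred i | g 0 i != 0]) delta_mx 0 i.
  rewrite big_enum /=; apply/rowP => j; rewrite summxE.
  have [gj|gj] := eqVneq (g 0 j) 0.
    rewrite gj big1// => i gi; rewrite mxE eqxx /=.
    by case: eqP => // e; move: gi; rewrite -e !inE gj eqxx.
  rewrite (bigD1 j)//= mxE !eqxx big1 ?addr0.
    by apply: val_inj; move: gj; case: (g 0 j) => [[|[|//]] ?].
  by move=> i /andP[_ ij]; rewrite mxE eqxx eq_sym (negbTE ij).
have gs : sign_change (\sum_(i <- enum [pred i | g 0 i != 0]) delta_mx 0 i) q = q.
  by rewrite -gE.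
have [|w ew] := gen _ _ gs.
  move=> i; rewrite mem_enum inE => gi.
  have := congr1 (fun r : 'rV_n => r 0 i) gq; rewrite sign_changeE (negbTE gi) => e; lra.
by exists w; rewrite ew; apply: mirror_eq.
Qed.

(** The invariant carried along a path: up to homotopy, F is a product of generators followed by a
    segment inside the chamber just reached. *)
Definition generated x (F : R -> 'rV[R]_n) := exists k,
  [/\ exists w, eval_word x_ w = orbi_class k, chamber_at (orbi_sign k) x &
      homotopic Z F (path_cat (orbi_fun k) (seg (sign_change (orbi_sign k) z0) x))].

Lemma generated_homotopic x F F' : homotopic Z F F' -> generated x F -> generated x F'.
Proof.
move=> FF' [k [kw kx hF]]; exists k; split=> //.
exact: homotopic_trans (homotopic_sym FF') hF.
Qed.

Lemma generated_seg x y F : is_path Z z0 x F -> Z x -> Z y -> cochamber x y ->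
  generated x F -> generated y (path_cat F (seg x y)).
Proof.
move=> pF Zx Zy xy [k [[w ew] kx hF]].
have [h [hx hy]] := cochamberP xy.
set g := orbi_sign k in kx hF.
(* The point x folded back into the positive orthant. As x lies in the chambers g and h, [g + h]
   fixes q, and the change of chamber at x is a mirror at q. *)
pose q := sign_change g x.
have Zq : Z q by exact: Z_sign.
have oq : orthant q by exact: kx.
have ghq : sign_change (g + h) q = q.
  by rewrite sign_change_addK; apply/esym; exact: sign_change_chamber.
have [w' ew'] := mirror_word Zq oq ghq.
pose k' := orbi_mul k (OrbiPath (mirror_fun_path Zq oq ghq)).
have sk' : orbi_sign k' = h by rewrite /= -/g addrA Z2_addrr add0r.
exists k'; rewrite sk'; split=> //.
  by exists (w ++ w'); rewrite eval_word_cat ew ew' orbi_classM.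
rewrite /= -/g /mirror_fun comp_path_cat !sign_change_comp_seg sign_changeK.
rewrite -[sign_change g (sign_change _ z0)]/((sign_change g \o sign_change (g + h)) z0).
rewrite -sign_changeD addrA Z2_addrr add0r.
have pk := orbi_pathP k; rewrite -/g in pk.
have pA := is_path_seg_z0 Zx kx.
have pB := is_path_rev (is_path_seg_z0 Zx hx); rewrite path_rev_seg in pB.
have pC := is_path_seg_z0 Zy hy.
have pxy := is_path_seg convexP Zx Zy xy.
have Zhz : Z (sign_change h z0) by apply: Z_sign; exact: Zz0.
have hz : chamber_at h (sign_change h z0) by apply: chamber_sign; exact: orthant_z0.
apply: (homotopic_trans (homotopic_catr pF (is_path_cat pk pA) pxy hF) _).
(* A detour through [sign_change h z0] replaces the segment from x to y: its first half completes
   the mirror path, its second half is the new final segment. *)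
have hBC := homotopic_seg_cat convexP Zx Zhz Zy hx hz hy.
have h1 := homotopic_catl (is_path_cat pk pA) (is_path_cat pB pC) pxy hBC.
apply: (homotopic_trans (homotopic_sym h1) _).
apply: (homotopic_trans (homotopic_catA (is_path_cat pk pA) pB pC) _).
apply: (homotopic_catr _ _ pC).
- exact: is_path_cat (is_path_cat pk pA) pB.
- exact: is_path_cat pk (is_path_cat pA pB).
- exact: homotopic_sym (homotopic_catA pk pA pB).
Qed.

(* A path from z stays near each of its points f s0 in the chambers through   *)
(* f s0, so it can be replaced there by two segments meeting at f s0, and a   *)
(* change of chamber at a point is a product of reflections at that point.    *)
Lemma orbifold_group_generated (c : orbifold_group z) : exists w, eval_word x_ w = c.
Proof.
rewrite -(orbi_classK c); move: (repr c) => f.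
have pf := orbi_pathP f; have [cf Zf f0 f1] := pf.
suff : generated (orbi_fun f 1) (subpath (orbi_fun f) 0 1).
  rewrite subpath01 f1 => -[k [[w ew] kx hF]]; exists w; rewrite ew.
  have sk := chamber_z0 kx; apply/orbi_classP; split=> //.
  apply: homotopic_sym; apply: (homotopic_trans hF _); rewrite -sk.
  have -> : seg (sign_change (orbi_sign k) z0) (sign_change (orbi_sign k) z0) =
      cst (sign_change (orbi_sign k) z0) by apply/funext => t; rewrite segxx.
  exact: homotopic_cat_cst (orbi_pathP k).
have sub a b : I a -> I b -> is_path Z (orbi_fun f a) (orbi_fun f b) (subpath (orbi_fun f) a b).
  exact: is_path_subpath pf.
apply: (unit_interval_induction (Q := fun s => generated (orbi_fun f s) (subpath (orbi_fun f) 0 s))).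
  exists (orbi_one z); split.
  - by exists [::]; rewrite eval_word_nil.
  - by rewrite f0; apply: chamber_at0; exact: orthant_z0.
  - rewrite /= f0 sign_change0.
    have -> : seg z0 z0 = cst z0 by apply/funext => t; rewrite segxx.
    have -> : subpath (orbi_fun f) 0 0 = cst z0.
      by apply/funext => u; rewrite /subpath subrr mulr0 addr0 f0.
    by apply: homotopic_sym; apply: homotopic_cat_cst; apply: is_path_cst; exact: Zz0.
move=> s0 Is0; have [d d0 near_s0] := cochamber_near pf Is0.
exists d => // s s' Is Is' ss ss' gs.
have Zs := Zf _ Is; have Zs' := Zf _ Is'; have Zs0 := Zf _ Is0.
have c1 : cochamber (orbi_fun f s) (orbi_fun f s0) by exact: near_s0.
have c2 : cochamber (orbi_fun f s0) (orbi_fun f s').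
  by move=> i; rewrite mulrC; exact: near_s0.
have p0 := sub _ _ I0 Is; rewrite f0 in p0.
have p1 := is_path_seg convexP Zs Zs0 c1.
have p2 := is_path_seg convexP Zs0 Zs' c2.
have g1 := generated_seg p0 Zs Zs0 c1 gs.
have g2 := generated_seg (is_path_cat p0 p1) Zs0 Zs' c2 g1.
apply: generated_homotopic g2; apply: homotopic_sym.
apply: (homotopic_trans (homotopic_sym (homotopic_subpath_cat pf I0 Is Is')) _).
apply: (homotopic_trans _ (homotopic_catA p0 p1 p2)).
apply: (homotopic_catl p0 (sub _ _ Is Is') (is_path_cat p1 p2) _).
apply: (homotopic_star convexP (sub _ _ Is Is') Zs0 _) => u /IE Iu.
apply: near_s0.
  by move/IE: Is => ?; move/IE: Is' => ?; apply/IE; nra.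
rewrite (_ : s0 - _ = (1 - u) * (s0 - s) + u * (s0 - s')); last by ring.
apply: le_lt_trans (ler_normD _ _) _; rewrite !normrM.
rewrite (ger0_norm (_ : 0 <= u)) ?(ger0_norm (_ : 0 <= 1 - u)); try lra.
(* One of the weights u and 1 - u is at least 1/2, which keeps the inequality strict. *)
by case/andP: Iu => u0 u1; have [?|?] := leP u (1/2); nra.
Qed.

End Generators.
End OrbifoldGeneration.

(** * The octahedron *)

Section Quadrants.
Context {R : realType}.
Implicit Types (n q : int) (th d : R).

(* A plane path from the polar angle th to the angle th + d, where 0 < th <   *)
(* pi / 2 and th + d lies in the n-th quadrant, joins a point to its image    *)
(* under the sign changes sl and sh of the coordinates.                       *)
Definition quadrant n (sl sh : bool) th d : Prop := exists q,
  [\/ [/\ n = 4 * q, ~~ sl, ~~ sh & d = 2 * pi * q%:~R],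
      [/\ n = 4 * q + 1, sl, ~~ sh & d = 2 * pi * q%:~R + pi - 2 * th],
      [/\ n = 4 * q + 2, sl, sh & d = 2 * pi * q%:~R + pi] |
      [/\ n = 4 * q + 3, ~~ sl, sh & d = 2 * pi * q%:~R + 2 * pi - 2 * th]].

Lemma quadrant0 th : quadrant 0 false false th 0.
Proof. by exists 0; constructor 1; split=> //; rewrite mulr0. Qed.

(** The wall of [lo k] is at angle pi / 2. Going from th through it to the mirror image of the start
    adds pi - 2 th, and the reflected path then contributes - d. In [quadrant_hi] the wall is at
    angle 0. *)
Lemma quadrant_lo n sl sh th d : quadrant n sl sh th d ->
  quadrant (1 - n) (~~ sl) sh th (pi - 2 * th - d).
Proof.
case=> q [] [nq hl hh ->].
- by exists (- q); constructor 2; split=> //; [lia|rewrite intrN; ring].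
- by exists (- q); constructor 1; split=> //; [lia|rewrite hl|rewrite intrN; ring].
- by exists (- q - 1); constructor 4; split=> //; [lia|rewrite hl|rewrite intrB intrN; ring].
- by exists (- q - 1); constructor 3; split=> //; [lia|rewrite intrB intrN; ring].
Qed.

Lemma quadrant_hi n sl sh th d : quadrant n sl sh th d ->
  quadrant (-1 - n) sl (~~ sh) th (- 2 * th - d).
Proof.
case=> q [] [nq hl hh ->]; exists (- q - 1).
- by constructor 4; split=> //; [lia|rewrite intrB intrN; ring].
- by constructor 3; split=> //; [lia|rewrite intrB intrN; ring].
- by constructor 2; split=> //; [lia|rewrite hh|rewrite intrB intrN; ring].
- by constructor 1; split=> //; [lia|rewrite hh|rewrite intrB intrN; ring].
Qed.

Lemma quadrant_bound n sl sh th d : 0 < th < pi / 2 -> quadrant n sl sh th d ->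
  n%:~R * (pi / 2) < th + d < (n + 1)%:~R * (pi / 2).
Proof. by move=> th0 [q] [] [-> _ _ ->]; rewrite !(intrD, intrM); lra. Qed.

Lemma quadrant_inj n n' sl sh sl' sh' th d : 0 < th < pi / 2 ->
  quadrant n sl sh th d -> quadrant n' sl' sh' th d -> n = n'.
Proof.
move=> th0 /(quadrant_bound th0) b /(quadrant_bound th0) b'.
have pi0 : 0 < pi / 2 :> R by lra.
have lt m m' : m%:~R * (pi / 2) < m'%:~R * (pi / 2) :> R -> (m < m')%R.
  by rewrite ltr_pM2r// ltr_int.
have h1 : (n < n' + 1)%R by apply: lt; lra.
have h2 : (n' < n + 1)%R by apply: lt; lra.
lia.
Qed.

Lemma quadrant_loop n th d : quadrant n false false th d ->
  exists q, n = 4 * q /\ d = 2 * pi * q%:~R.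
Proof. by case=> q [] [] // -> _ _ ->; exists q. Qed.

End Quadrants.

Section Octahedron.
Context {R : realType} {P : set 'rV[R]_8}.
Context (convexP : forall (x y : 'rV[R]_8) (t : R), P x -> P y ->
  (unit_interval : set R) t -> P ((1 - t) *: x + t *: y)).
Context (opposite_disjoint : forall x k, P x -> x 0 (lo k) = 0 -> x 0 (hi k) <> 0).
Implicit Types (x y : 'rV[R]_8) (f h : R -> 'rV[R]_8) (g : 'rV['Z_2]_8) (k : 'I_4).
Local Notation Z := (square_preimage P).
Local Notation I := (unit_interval : set R).

Definition wind k f := winding (fun s => f s 0 (lo k)) (fun s => f s 0 (hi k)).

Lemma Z_opposite_gt0 x k : Z x -> 0 < x 0 (lo k) ^+ 2 + x 0 (hi k) ^+ 2.
Proof.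
move=> Zx; rewrite lt_neqAle addr_ge0 ?sqr_ge0// andbT eq_sym.
rewrite paddr_eq0 ?sqr_ge0//; apply/negP => /andP[/eqP lk /eqP hk].
by apply: (opposite_disjoint (k := k) Zx); rewrite mxE.
Qed.

Lemma Z_plane_path k x y f : is_path Z x y f ->
  plane_path (fun s => f s 0 (lo k)) (fun s => f s 0 (hi k)).
Proof.
by move=> [cf Zf _ _]; split; [exact: within_coord|exact: within_coord|
  move=> s Is; apply: Z_opposite_gt0; exact: Zf].
Qed.

Lemma eq_wind k f h : (forall s, I s -> f s = h s) -> wind k f = wind k h.
Proof. by move=> fh; apply: eq_winding => s Is; rewrite fh. Qed.

Lemma wind_homotopic k x y f h : is_path Z x y f -> homotopic Z f h ->
  wind k f = wind k h.
Proof.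
move=> [_ _ f0 f1] [H [cH ZH H0 H1]].
have e (s : R) : I s -> H (s, 0) = f s by move=> /H0[].
have e' (s : R) : I s -> H (s, 1) = h s by move=> /H0[].
rewrite -(eq_wind k e) -(eq_wind k e').
apply: (winding_homotopy (H1 := fun p => H p 0 (lo k)) (H2 := fun p => H p 0 (hi k))).
- exact: within_coord.
- exact: within_coord.
- by move=> p /ZH; exact: Z_opposite_gt0.
- by move=> t It; have [-> _] := H1 t It; have [-> _] := H1 0 I0.
- by move=> t It; have [_ ->] := H1 t It; have [_ ->] := H1 0 I0.
Qed.

Lemma wind_cat k x y w f h : is_path Z x y f -> is_path Z y w h ->
  wind k (path_cat f h) = wind k f + wind k h.
Proof.
move=> pf ph; have [_ _ _ f1] := pf; have [_ _ h0 _] := ph.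
have c i : (fun s => path_cat f h s 0 i) = path_cat (fun s => f s 0 i) (fun s => h s 0 i).
  by apply/funext => s; rewrite /path_cat; case: ifP.
rewrite /wind !c; apply: winding_cat; rewrite ?f1 ?h0//.
  exact: Z_plane_path pf.
exact: Z_plane_path ph.
Qed.

Lemma wind_rev k x y f : is_path Z x y f -> wind k (path_rev f) = - wind k f.
Proof. by move=> pf; exact: winding_rev (Z_plane_path k pf). Qed.

(** The determinant of g on the k-th coordinate plane, hence the factor by which it multiplies
    variations of angle. *)
Definition orientation k g : R := if (g 0 (lo k) == 0) == (g 0 (hi k) == 0) then 1 else -1.

Lemma orientation_sq k g : orientation k g * orientation k g = 1.
Proof. by rewrite /orientation; case: ifP => _; rewrite ?mulr1// mulrNN mulr1. Qed.

Lemma wind_sign k g x y f : is_path Z x y f ->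
  wind k (sign_change g \o f) = orientation k g * wind k f.
Proof.
move=> pf; have pp := Z_plane_path k pf; have [c1 c2 p0] := pp.
rewrite /wind /orientation.
have -> : (fun s => (sign_change g \o f) s 0 (lo k)) =
    if g 0 (lo k) == 0 then fun s => f s 0 (lo k) else fun s => - f s 0 (lo k).
  by apply/funext => s; rewrite /= sign_changeE; case: ifP.
have -> : (fun s => (sign_change g \o f) s 0 (hi k)) =
    if g 0 (hi k) == 0 then fun s => f s 0 (hi k) else fun s => - f s 0 (hi k).
  by apply/funext => s; rewrite /= sign_changeE; case: ifP.
case: (g 0 (lo k) == 0); case: (g 0 (hi k) == 0) => //=; rewrite ?mul1r ?mulN1r//.
- exact: winding_oppr.
- exact: winding_oppl.
- rewrite winding_oppl; first by rewrite winding_oppr// opprK.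
  split=> //; first by move=> s; apply: cvgN; exact: c2.
  by move=> s Is; rewrite sqrrN; exact: p0.
Qed.

Section Base.
Context (z : Z) (z_gt0 : forall i, 0 < set_val z 0 i).
Context (x_ : 'I_8 -> orbifold_group z).
Context (x_mirror : forall q i Zq oq qi, @facet_mirror R 8 P convexP z z_gt0 q i Zq oq qi = x_ i).
Context (ridge : forall i j, rev_ord i != j ->
  exists q, [/\ Z q, orthant q, q 0 i = 0 & q 0 j = 0]).
Local Notation z0 := (set_val z).

Definition base_angle k := quadrant_angle (z0 0 (lo k)) (z0 0 (hi k)).

Lemma base_angle_gt0 k : 0 < base_angle k < pi / 2.
Proof. exact: quadrant_angle_gt0. Qed.

(** The path is a leg in the positive orthant followed by its reversed mirror image, which counts
    with the factor - [orientation k g]. *)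
Lemma wind_mirror k q g : Z q -> orthant q -> sign_change g q = q ->
  wind k (mirror_fun z q g) = (1 - orientation k g) *
    (quadrant_angle (q 0 (lo k)) (q 0 (hi k)) - base_angle k).
Proof.
move=> Zq oq gq; have o0 : orthant z0 by exact: orthant_z0.
have p1 : is_path Z z0 q (seg z0 q).
  apply: (is_path_seg convexP) => //; first exact: Zz0.
  by apply: (@chamber_cochamber _ _ 0); exact: chamber_at0.
have e : seg q (sign_change g z0) = path_rev (sign_change g \o seg z0 q).
  by rewrite sign_change_comp_seg path_rev_seg gq.
have pg := is_path_sign g p1; rewrite gq in pg.
rewrite /mirror_fun e (wind_cat k p1 (is_path_rev pg)) (wind_rev k pg) (wind_sign k g p1).
suff -> : wind k (seg z0 q) = quadrant_angle (q 0 (lo k)) (q 0 (hi k)) - base_angle k.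
  by ring.
rewrite /wind winding_quadrant ?seg0 ?seg1//; first exact: Z_plane_path p1.
  by move=> s Is; apply: seg_orthant.
by move=> s Is; apply: seg_orthant.
Qed.

Lemma eval_letter i (b : bool) : (if b then (x_ i)^-1 else x_ i)%g = x_ i.
Proof.
case: b => //; have [q [Zq oq qi _]] : exists q, [/\ Z q, orthant q, q 0 i = 0 & q 0 i = 0].
  by apply: ridge; apply/eqP => /(congr1 val) /=; case: i => i ? /=; lia.
apply: (mulIg (x_ i)); rewrite mulVg.
by rewrite (generator_sq x_mirror Zq oq qi).
Qed.

(** A new first letter puts a mirror path in front and reflects the rest. On the angle of its own
    pair this acts as [quadrant_lo] or [quadrant_hi]; the other pairs see no change. *)
Lemma word_quadrant (w : word 'I_8) : exists f : orbi_path z,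
  orbi_class f = eval_word x_ w /\
  forall k, quadrant (chamber k w 0) (orbi_sign f 0 (lo k) != 0)
    (orbi_sign f 0 (hi k) != 0) (base_angle k) (wind k (orbi_fun f)).
Proof.
elim: w => [|[i b] w [f [ef qf]]].
  exists (orbi_one z); split; first by rewrite eval_word_nil.
  move=> k; rewrite /= !mxE eqxx /=.
  have -> : wind k (cst z0) = 0.
    have pc := is_path_cst (R := R) (Zz0 z).
    rewrite /wind winding_quadrant ?subrr//; first exact: Z_plane_path pc.
      by move=> s _ /=; apply: ltW.
    by move=> s _ /=; apply: ltW.
  exact: quadrant0.
have [q [Zq oq qi _]] : exists q, [/\ Z q, orthant q, q 0 i = 0 & q 0 i = 0].
  by apply: ridge; apply/eqP => /(congr1 val) /=; case: i => i ? /=; lia.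
pose m := OrbiPath (mirror_fun_path convexP z_gt0 Zq oq (delta_fix qi)).
exists (orbi_mul m f); split.
  rewrite eval_word_cons eval_letter /= -orbi_classM ef; congr (_ * _)%g.
  exact: (x_mirror Zq oq qi).
move=> k; have pf := orbi_pathP f; have pm := orbi_pathP m.
have -> : wind k (orbi_fun (orbi_mul m f)) = wind k (orbi_fun m) +
    orientation k (orbi_sign m) * wind k (orbi_fun f).
  by rewrite /orbi_mul [orbi_fun _]/= (wind_cat k pm (is_path_sign _ pf)) (wind_sign _ _ pf).
have -> : wind k (orbi_fun m) = (1 - orientation k (delta_mx 0 i)) *
    (quadrant_angle (q 0 (lo k)) (q 0 (hi k)) - base_angle k).
  by apply: wind_mirror => //; exact: delta_fix.
have q0 := Z_opposite_gt0 k Zq.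
have Z2E (a : 'Z_2) : (true%:R + a != 0) = ~~ (a != 0) by case: a => [[|[|//]] ?].
have Z21 : (true%:R == 0 :> 'Z_2) = false by [].
have Z20 : (false%:R == 0 :> 'Z_2) = true by [].
have := qf k; rewrite /= /orientation !mxE !eqxx /= /chamber_step.
have [ik|il] := eqVneq i (lo k).
  subst i; rewrite [hi k == lo k]eq_sym lo_neq_hi Z2E Z21 ?Z20 add0r => Q.
  rewrite qi quadrant_angle_l; last first.
    rewrite lt_neqAle (oq (hi k)) andbT eq_sym.
    by apply: contraTneq q0 => ->; rewrite qi expr0n addr0 ltxx.
  rewrite (_ : _ + _ * wind k (orbi_fun f) = pi - 2 * base_angle k - wind k (orbi_fun f)); last by rewrite /=; field.
  exact: quadrant_lo.
have [ih|ih] := eqVneq i (hi k).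
  subst i; rewrite eqxx Z2E Z21 ?Z20 add0r => Q.
  rewrite qi quadrant_angle_r; last first.
    rewrite lt_neqAle (oq (lo k)) andbT eq_sym.
    by apply: contraTneq q0 => ->; rewrite qi expr0n addr0 ltxx.
  rewrite (_ : _ + _ * wind k (orbi_fun f) = - 2 * base_angle k - wind k (orbi_fun f)); last by rewrite /=; ring.
  exact: quadrant_hi.
by rewrite ?Z20 !add0r subrr mul0r add0r mul1r.
Qed.

Lemma eval_word_inj (u v : word 'I_8) : eval_word x_ u = eval_word x_ v ->
  presented_eq octahedron_relators u v.
Proof.
have [f [ef qf]] := word_quadrant u; have [h [eh qh]] := word_quadrant v.
rewrite -ef -eh => /orbi_classP[_ fh]; apply: chamber_eqv => k.
apply: quadrant_inj (base_angle_gt0 k) (qf k) _.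
by rewrite (wind_homotopic k (orbi_pathP f) fh); exact: qh.
Qed.

Lemma octahedron_relator_eval r : octahedron_relators r -> eval_word x_ r = 1%g.
Proof.
case=> [[i ->]|[i [j [ij ->]]]].
  have := eval_letter i true; rewrite eval_word_sq => {2}<-; exact: mulgV.
have [|q [Zq oq qi qj]] := ridge (i := i) (j := j).
  apply/eqP => /(congr1 val) /= e.
  have : (i.+1 + j.+1 == 9)%N by move: (ltn_ord i) e; lia.
  (* Opposite facets are those whose numbers add up to 9; no listed pair does. *)
  have : all (fun p : nat * nat => p.1 + p.2 != 9)%N (adjacent_facets ++ vertex_facets) by [].
  move=> /allP /(_ (i.+1, j.+1)); rewrite mem_cat => h /eqP ij9.
  by have /h : ((i.+1, j.+1) \in adjacent_facets) || ((i.+1, j.+1) \in vertex_facets)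
    by [case: ij => ->; rewrite ?orbT]; rewrite ij9.
by apply: eval_word_comm1; exact: (generator_comm x_mirror Zq oq qi qj).
Qed.

Lemma octahedron_presentation : has_presentation x_ octahedron_relators.
Proof.
split; first by move=> c; exact: (orbifold_group_generated x_mirror).
move=> u v; split; first exact: eval_word_inj.
exact: presented_eq_eval octahedron_relator_eval u v.
Qed.

End Base.
End Octahedron.

(** * The four winding numbers of a loop *)

Section LoopWinding.
Context {R : realType} {P : set 'rV[R]_8}.
Context (convexP : forall (x y : 'rV[R]_8) (t : R), P x -> P y ->
  (unit_interval : set R) t -> P ((1 - t) *: x + t *: y)).
Context (opposite_disjoint : forall (x : 'rV[R]_8) k, P x -> x 0 (lo k) = 0 -> x 0 (hi k) <> 0).
Local Notation Z := (square_preimage P).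
Local Notation I := (unit_interval : set R).
Context (ridge : forall i j, rev_ord i != j ->
  exists q : 'rV[R]_8, [/\ Z q, orthant q, q 0 i = 0 & q 0 j = 0]).
Implicit Types (F : R -> 'rV[R]_8) (k : 'I_4).

Lemma generators_exist (b : Z) (b_gt0 : forall i, 0 < set_val b 0 i) :
  exists x_ : 'I_8 -> orbifold_group b,
    forall q i Zq oq qi, @facet_mirror R 8 P convexP b b_gt0 q i Zq oq qi = x_ i.
Proof.
have ex i : exists c : orbifold_group b,
    forall q Zq oq qi, @facet_mirror R 8 P convexP b b_gt0 q i Zq oq qi = c.
  have [|q [Zq oq qi _]] := @ridge i i.
    by apply/eqP => /(congr1 val) /=; case: i => i ? /=; lia.
  exists (facet_mirror convexP b_gt0 Zq oq qi) => q' Zq' oq' qi'.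
  exact: facet_reflection_uniq (facet_reflection_mirror convexP b_gt0 Zq' oq' qi').
exists (fun i => projT1 (cid (ex i))) => q i Zq oq qi.
exact: (projT2 (cid (ex i))).
Qed.

Lemma quadrant_mul4 m (sl sh : bool) (th d : R) : quadrant (4 * m) sl sh th d ->
  [/\ ~~ sl, ~~ sh & d = 2 * pi * m%:~R].
Proof.
case=> q [] [e hl hh ->]; last 3 first.
- by exfalso; clear -e; lia.
- by exfalso; clear -e; lia.
- by exfalso; clear -e; lia.
by split=> //; congr (_ * _%:~R); lia.
Qed.

Section Loops.
Context (b : Z) (b_gt0 : forall i, 0 < set_val b 0 i).
Context (x_ : 'I_8 -> orbifold_group b).
Context (x_mirror : forall q i Zq oq qi, @facet_mirror R 8 P convexP b b_gt0 q i Zq oq qi = x_ i).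
Context (z : Z) (g : 'rV['Z_2]_8) (gz : chamber_at g (set_val z)).
Local Notation b0 := (set_val b).
Local Notation z0 := (set_val z).

Let d : R -> 'rV[R]_8 := seg b0 (sign_change g z0).

Let pd : is_path Z b0 (sign_change g z0) d.
Proof.
apply: (is_path_seg convexP); first exact: Zz0.
  by apply: Z_sign; exact: Zz0.
by apply: (@chamber_cochamber _ _ 0); apply: chamber_at0 => //; exact: orthant_z0.
Qed.

(** The base point z may lie on walls, while the results on words need a base point with positive
    coordinates. Here g folds z into the positive orthant and d joins b to the image. *)
Definition based_loop F := path_cat (path_cat d (sign_change g \o F)) (path_rev d).

Lemma based_loop_path F : is_path Z z0 z0 F ->
  is_path Z b0 (sign_change 0 b0) (based_loop F).
Proof.
move=> pF; rewrite sign_change0.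
exact: is_path_cat (is_path_cat pd (is_path_sign g pF)) (is_path_rev pd).
Qed.

Lemma wind_based_loop k F : is_path Z z0 z0 F ->
  wind k (based_loop F) = orientation k g * wind k F.
Proof.
move=> pF; have pg := is_path_sign g pF.
rewrite /based_loop (wind_cat opposite_disjoint k (is_path_cat pd pg) (is_path_rev pd)).
rewrite (wind_cat opposite_disjoint k pd pg) (wind_rev opposite_disjoint k pd).
by rewrite (wind_sign opposite_disjoint k g pF) addrAC subrr add0r.
Qed.

Lemma loop_word F : is_path Z z0 z0 F -> exists w : word 'I_8, exists f : orbi_path b,
  [/\ orbi_class f = eval_word x_ w, orbi_sign f = 0, orbi_fun f = based_loop F &
    forall k, exists q : int, chamber k w 0 = 4 * q /\
      orientation k g * wind k F = 2 * pi * q%:~R].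
Proof.
move=> pF; pose f := OrbiPath (based_loop_path pF).
have [w ew] := orbifold_group_generated x_mirror (orbi_class f).
exists w, f; split=> // k.
have [h [eh qh]] := word_quadrant opposite_disjoint x_mirror ridge w.
have /orbi_classP[sh hh] : orbi_class h = orbi_class f by rewrite eh.
have := qh k; rewrite sh /= !mxE eqxx => /quadrant_loop[q [cq wq]]; exists q; split=> //.
rewrite -wq (wind_homotopic opposite_disjoint k (orbi_pathP h) hh) /=.
by rewrite wind_based_loop.
Qed.

Lemma loop_wind_int k F : is_path Z z0 z0 F -> exists m : int, wind k F = 2 * pi * m%:~R.
Proof.
move=> /loop_word[w [f [_ _ _ /(_ k)[q [_ e]]]]].
have := orientation_sq (R := R) k g.
move: e; rewrite /orientation; case: ifP => _; rewrite ?mul1r ?mulN1r => e _.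
  by exists q.
by exists (- q); rewrite intrN mulrN -e opprK.
Qed.

(** Equal windings give equal chambers, hence equivalent words and equal classes at b; the
    conjugation by d and the sign change g are then undone. *)
Lemma loop_homotopic_wind F F' : is_path Z z0 z0 F -> is_path Z z0 z0 F' ->
  (forall k, wind k F = wind k F') -> homotopic Z F F'.
Proof.
move=> pF pF' FF'.
have [w [f [ef sf ff wf]]] := loop_word pF.
have [w' [f' [ef' sf' ff' wf']]] := loop_word pF'.
have pi0 : 2 * pi != 0 :> R by rewrite mulf_neq0 ?pnatr_eq0// gt_eqF// pi_gt0.
have : presented_eq octahedron_relators w w'.
  apply: chamber_eqv => k; have [q [-> e]] := wf k; have [q' [-> e']] := wf' k.
  congr (_ * _); apply: (@intr_inj R); apply: (mulfI pi0).
  by rewrite -e -e' FF'.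
move=> /(presented_eq_eval (octahedron_relator_eval x_mirror ridge)) e.
have /orbi_classP[_] : orbi_class f = orbi_class f' by rewrite ef ef'.
rewrite ff ff' => h.
have := homotopic_conj_inj (is_path_sign g pF) (is_path_sign g pF') pd h.
move=> /(homotopic_sign (P := P) g).
have gg h' : sign_change g \o (sign_change g \o h') = h' :> (R -> 'rV[R]_8).
  by apply/funext => s /=; rewrite sign_changeK.
by rewrite !gg.
Qed.

(** Take the normal word with chambers 4 ([o k] * [N k]). Multiples of 4 force all signs to be
    trivial, so its path closes up, and [o k] compensates for the orientation of g. *)
Lemma loop_with_wind (N : 'I_4 -> int) : exists F, is_path Z z0 z0 F /\
  forall k, wind k F = 2 * pi * (N k)%:~R.
Proof.
pose o k : int := if (g 0 (lo k) == 0) == (g 0 (hi k) == 0) then 1 else -1.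
have oE k : orientation k g = (o k)%:~R :> R.
  by rewrite /orientation /o; case: ifP.
have [f [ef qf]] := word_quadrant opposite_disjoint x_mirror ridge
  (normal_word (enum 'I_4) (fun k => 4 * (o k * N k))).
have q4 k : [/\ orbi_sign f 0 (lo k) = 0, orbi_sign f 0 (hi k) = 0 &
    wind k (orbi_fun f) = 2 * pi * (o k * N k)%:~R].
  have := qf k; rewrite chamber_normal => /quadrant_mul4[hl hh ->].
  by split=> //; apply/eqP; rewrite -[_ == _]negbK.
have sf : orbi_sign f = 0.
  apply/rowP => i; rewrite [RHS]mxE; have [k] := lo_or_hi i.
  by have [e1 e2 _] := q4 k; case=> ->.
have pf := orbi_pathP f; rewrite sf sign_change0 in pf.
have pr := is_path_rev pd; have p1 := is_path_cat pr pf.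
have p2 := is_path_cat p1 pd.
exists (sign_change g \o path_cat (path_cat (path_rev d) (orbi_fun f)) d); split.
  by have := is_path_sign g p2; rewrite sign_changeK.
move=> k; rewrite (wind_sign opposite_disjoint k g p2).
rewrite (wind_cat opposite_disjoint k p1 pd) (wind_cat opposite_disjoint k pr pf).
rewrite (wind_rev opposite_disjoint k pd); have [_ _ ->] := q4 k.
rewrite addrAC addNr add0r mulrCA; congr (_ * _).
by rewrite intrM mulrA -oE orientation_sq mul1r.
Qed.

Lemma fundamental_group_Z4 : exists phi : fundamental_group R z -> 'rV[int]_4,
  bijective phi /\ (forall a b, phi (a * b)%g = phi a + phi b).
Proof.
have pi0 : 2 * pi != 0 :> R by rewrite mulf_neq0 ?pnatr_eq0// gt_eqF// pi_gt0.
pose phi (a : fundamental_group R z) : 'rV[int]_4 :=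
  (* The quotient is an integer by [loop_wind_int]; [Num.floor] only reads it off. *)
  \row_k Num.floor (wind k (repr a) / (2 * pi)).
have phiE (a : fundamental_group R z) k : wind k (repr a) = 2 * pi * (phi a 0 k)%:~R.
  have [m e] := loop_wind_int k (path_typeP (repr a)).
  have me : 2 * pi * m%:~R / (2 * pi) = m%:~R :> R by rewrite mulrAC divff// mul1r.
  by rewrite mxE e me intrKfloor.
exists phi; split; last first.
  move=> a c; apply/rowP => k; rewrite [RHS]mxE.
  apply: (@intr_inj R); apply: (mulfI pi0).
  rewrite -[LHS]/(2 * pi * _) -phiE -[RHS]/(2 * pi * _) intrD mulrDr -!phiE.
  rewrite -(wind_cat opposite_disjoint k (path_typeP (repr a)) (path_typeP (repr c))).
  apply: (wind_homotopic opposite_disjoint k (path_typeP (repr (a * c)%g))).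
  apply: (proj1 (loop_classP (repr (a * c)%g) (loop_mul (repr a) (repr c)))).
  by rewrite loop_classK.
have inj : injective phi.
  move=> a c e; rewrite -(loop_classK a) -(loop_classK c); apply/loop_classP.
  apply: loop_homotopic_wind; try exact: path_typeP.
  by move=> k; rewrite !phiE e.
have surj v : exists a, phi a = v.
  have [F [pF wF]] := loop_with_wind (fun k => v 0 k).
  exists (loop_class (Path pF)); apply/rowP => k.
  apply: (@intr_inj R); apply: (mulfI pi0); rewrite -phiE -wF.
  apply: (wind_homotopic opposite_disjoint k (path_typeP _)).
  by apply/(loop_classP (repr (loop_class (Path pF))) (Path pF)); rewrite loop_classK.
exists (fun v => projT1 (cid (surj v))) => [a|v].
  by apply: inj; exact: (projT2 (cid (surj (phi a)))).
exact: (projT2 (cid (surj v))).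
Qed.
End Loops.
End LoopWinding.

(** * Convexity and incidences of the embedded octahedron *)

Section OctahedronGeometry.
Context {R : realType} {P : set 'rV[R]_8}.
Context (embP : geometrically_embedded P) (octP : octahedron P).
Local Notation Z := (square_preimage P).

Lemma embedded_orthant : P `<=` orthant.
Proof. by case: embP => _ [L [d [[_ _ _ ->] _]]] x []. Qed.

Lemma embedded_convex (x y : 'rV[R]_8) (t : R) : P x -> P y ->
  (unit_interval : set R) t -> P ((1 - t) *: x + t *: y).
Proof.
case: embP => _ [L [d [[[p [V [-> _]]] _ _ ->] _]]].
move=> [/= xV ox] [/= yV oy] /IE t01; split=> /=.
  rewrite (_ : _ - p = (1 - t) *: (x - p) + t *: (y - p)); first by rewrite memvD// memvZ.
  by apply/rowP => i; rewrite !mxE; ring.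
by move=> i; rewrite !mxE; have := ox i; have := oy i; nra.
Qed.

Lemma octahedron_vertices : exists v : 'I_6 -> 'rV[R]_8,
  [/\ forall a, P (v a), forall w, is_vertex P w -> exists a, v a = w &
      forall (i : 'I_8) (a : 'I_6), v a 0 i = 0 <->
        (a : nat) \in nth [::] octahedron_facets i].
Proof.
have [_ [v [_ rv inc]]] := octP; exists v.
have Pv a : P (v a).
  have : is_vertex P (v a) by rewrite -[is_vertex P _]/([set u | is_vertex P u] _) -rv; exists a.
  by move=> [c [b [_ e]]]; have : [set v a] (v a) by []; rewrite e => -[].
split=> //.
  by move=> w; rewrite -[is_vertex P _]/([set u | is_vertex P u] _) -rv => -[a _ <-]; exists a.
by move=> i a; rewrite -inc; split=> [|[]//].
Qed.

(** A common point would yield a common vertex by [vertex_in_coordinate_face], and the incidence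
    table has none. *)
Lemma opposite_facets_disjoint (x : 'rV[R]_8) k : P x -> x 0 (lo k) = 0 -> x 0 (hi k) <> 0.
Proof.
move=> Px xl xh; have [polP _] := embP.
have [w [vw wl wh]] := vertex_in_coordinate_face polP embedded_orthant Px xl xh.
have [v [_ vP inc]] := octahedron_vertices; have [a aw] := vP w vw.
move: wl wh; rewrite -aw => /inc al /inc ah.
have : all (fun i => all (fun a => ~~ ((a \in nth [::] octahedron_facets i) &&
    (a \in nth [::] octahedron_facets (7 - i)))) (iota 0 6)) (iota 0 4) by [].
move=> /allP /(_ k); rewrite mem_iota => /(_ (ltn_ord k)) /allP /(_ a).
rewrite mem_iota => /(_ (ltn_ord a)); rewrite al /= -[(7 - k)%N]/(hi k : nat).
by rewrite ah.
Qed.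

Lemma sqrt_in_Z (p : 'rV[R]_8) : P p -> let q := \row_i Num.sqrt (p 0 i) in
  [/\ Z q, orthant q & forall i, p 0 i = 0 -> q 0 i = 0].
Proof.
move=> Pp q; split=> [|i|i pi0]; last 2 first.
- by rewrite mxE sqrtr_ge0.
- by rewrite mxE pi0 sqrtr0.
rewrite /square_preimage /= (_ : \row_i _ = p)//; apply/rowP => i.
by rewrite !mxE sqr_sqrtr//; exact: embedded_orthant.
Qed.

(** Facets that are not opposite share a vertex, and the square roots of its coordinates give q.
    With i = j this supplies a point on each facet. *)
Lemma octahedron_ridge (i j : 'I_8) : rev_ord i != j ->
  exists q : 'rV[R]_8, [/\ Z q, orthant q, q 0 i = 0 & q 0 j = 0].
Proof.
move=> ij; have [v [Pv _ inc]] := octahedron_vertices.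
have : all (fun i => all (fun j => (i + j == 7)%N || has (fun a =>
    (a \in nth [::] octahedron_facets i) && (a \in nth [::] octahedron_facets j))
    (iota 0 6)) (iota 0 8)) (iota 0 8) by [].
move=> /allP /(_ i); rewrite mem_iota => /(_ (ltn_ord i)) /allP /(_ j).
rewrite mem_iota => /(_ (ltn_ord j)) /orP[/eqP e|/hasP[a]].
  by move/eqP: ij; case; apply: val_inj => /=; lia.
rewrite mem_iota /= => a6 /andP[ai aj].
have [Zq oq qz] := sqrt_in_Z (Pv (Ordinal a6)).
by eexists; split; [exact: Zq|exact: oq|apply: qz; apply/inc|apply: qz; apply/inc].
Qed.

Lemma octahedron_interior : exists b : Z, forall i, 0 < set_val b 0 i.
Proof.
have [v [Pv _ inc]] := octahedron_vertices.
(* Successive midpoints with the vertices keep positive every coordinate that is positive at some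
   vertex used; each facet misses a vertex. *)
have mid (s : seq 'I_6) : exists2 p, P p & forall a i, a \in s -> 0 < v a 0 i -> 0 < p 0 i.
  elim: s => [|a s [p Pp pp]]; first by exists (v ord0).
  exists ((1 - 1 / 2) *: p + (1 / 2) *: v a).
    by apply: embedded_convex => //; apply/IE; lra.
  move=> c i; have := embedded_orthant Pp i; have := embedded_orthant (Pv a) i.
  rewrite inE !mxE => va pi /orP[/eqP->|cs] vc; first by lra.
  by have := pp c i cs vc; lra.
have [p Pp pv] := mid (enum 'I_6); have [Zq _ _] := sqrt_in_Z Pp.
exists (exist (fun x : 'rV[R]_8 => x \in Z) _ (mem_set Zq)) => i; rewrite /= mxE sqrtr_gt0.
have : all (fun i => has (fun a => a \notin nth [::] octahedron_facets i) (iota 0 6)) (iota 0 8) by [].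
move=> /allP /(_ i); rewrite mem_iota => /(_ (ltn_ord i)) /hasP[a].
rewrite mem_iota /= => a6 ai; apply: (pv (Ordinal a6)); first by rewrite mem_enum.
rewrite lt_neqAle embedded_orthant// andbT eq_sym; apply/eqP => /inc /=.
exact/negP.
Qed.
End OctahedronGeometry.

Theorem proposition5p4 (R : realType) (P : set 'rV[R]_8)
    (embP : geometrically_embedded P) (octP : octahedron P) :
  (forall z : square_preimage P, (forall i, 0 < set_val z 0 i) ->
     exists x : 'I_8 -> orbifold_group z,
       (forall i c, facet_reflection i c <-> c = x i) /\
       has_presentation x octahedron_relators) /\
  (forall z : square_preimage P,
     exists phi : fundamental_group R z -> 'rV[int]_4,
       bijective phi /\ (forall a b, phi (a * b)%g = phi a + phi b)).
Proof.
have cP := embedded_convex embP; have oP := opposite_facets_disjoint embP octP.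
have rP := octahedron_ridge embP octP; split=> z.
  move=> z_gt0; have [x_ x_mirror] := generators_exist cP rP z_gt0.
  exists x_; split; last exact: (octahedron_presentation oP x_mirror rP).
  move=> i c; have [|q [Zq oq qi _]] := rP i i.
    by apply/eqP => /(congr1 val) /=; case: i => i ? /=; lia.
  rewrite -(x_mirror q i Zq oq qi); split; first exact: facet_reflection_uniq.
  by move=> ->; exact: facet_reflection_mirror.
have [b b_gt0] := octahedron_interior embP octP.
have [x_ x_mirror] := generators_exist cP rP b_gt0.
(* Applied to z twice, this only chooses a chamber containing z. *)
have [|g [gz _]] := @cochamberP _ _ (set_val z) (set_val z).
  by move=> i; rewrite -expr2 sqr_ge0.
exact: (fundamental_group_Z4 oP rP x_mirror gz).
Qed.
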